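(* Let $S\subseteq\mathbb{N}$. Then the following are equivalent. (a) $S$ is rational-MICP representable. (b) There exists $k\in\mathbb{N}$ such that $S=A_0\cup\left(\bigcup_{i=1}^k A_i\right)$, where $A_0\subseteq\mathbb{N}$ is a finite set and for each $i=1,\dots,k$, $A_i\subseteq\mathbb{N}$ is an infinite arithmetic progression. (c) There exist a finite set $A_0$ and a rational-MILP representable set $T$ such that $S=A_0\cup T$.
   Context: $\mathbb{N}=\{0,1,2,\dots\}$, viewed as a subset of $\mathbb{R}$. For sets with variables $(x,y)\in\mathbb{R}^n\times\mathbb{R}^p$ or $(x,y,z)\in\mathbb{R}^n\times\mathbb{R}^p\times\mathbb{R}^d$, $\operatorname{proj}_x$ denotes projection onto the $x$ variables; here $n=1$. Infinite arithmetic progression: a set of natural numbers of the form $\{am+b : m\in\mathbb{N}\}$ for some fixed $a,b\in\mathbb{N}$. Rational-MILP representable: $T\subseteq\mathbb{R}^n$ is rational-MILP representable if there exist $p,d\in\mathbb{N}$ and a rational polyhedron $M\subseteq\mathbb{R}^{n+p+d}$ (a polyhedron defined by finitely many linear inequalities with rational coefficients) such that $T=\operatorname{proj}_x\big(M\cap(\mathbb{R}^{n+p}\times\mathbb{Z}^d)\big)$. Closed convex family: let $C\subseteq\mathbb{R}^d$ be convex and $(A_z)_{z\in C}$ a family of convex sets in $\mathbb{R}^N$. The family is convex if $\lambda A_z+(1-\lambda)A_{z'}\subseteq A_{\lambda z+(1-\lambda)z'}$ for all $z,z'\in C$, $\lambda\in[0,1]$. It is moreover closed if each $A_z$ is closed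 and for any convergent sequences $(z_m)$, $(x_m)$ with $z_m\in C$, $x_m\in A_{z_m}$ and $\lim z_m\in C$, we have $\lim x_m\in A_{\lim z_m}$. An MICP representation of $S\subseteq\mathbb{R}^n$ with convex family $(A_z)_{z\in C}$ consists of $d,p\in\mathbb{N}$, a convex set $C\subseteq\mathbb{R}^d$ and a closed convex family $(A_z)_{z\in C}$ in $\mathbb{R}^{n+p}$ such that $S=\bigcup_{z\in C\cap\mathbb{Z}^d}\operatorname{proj}_x(A_z)$. Rationally unbounded: an unbounded convex set $C\subseteq\mathbb{R}^d$ is rationally unbounded if for every rational linear mapping of $C$ (linear map $\mathbb{R}^d\to\mathbb{R}^d$ with rational matrix), the image $C'$ of $C$ is either bounded or there exists $r\in\mathbb{Z}^d\setminus\{0\}$ such that $x+\lambda r\in C'$ for every $x\in\mathbb{Z}^d\cap C'$ and every $\lambda\ge 0$. An infinite set $A\subseteq\mathbb{Z}^d$ is rationally unbounded if there exists a finite subset $I\subset A$ such that $\operatorname{conv}(A\setminus I)$ is rationally unbounded. Rational-MICP representable: $S$ is rational-MICP representable if there exists an MICP representation of $S$ with convex family $(A_z)_{z\in C}$ with $A_z\ne\emptyset$ for all $z\in C$, such that the set of integer points $C\cap\mathbb{Z}^d$ is either bounded or rationally unbounded. *)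

(* Defs.v *)
From HB Require Import structures.
From mathcomp Require Import all_boot all_order all_algebra.
From mathcomp Require Import all_classical all_reals all_analysis.

Set Implicit Arguments.
Unset Strict Implicit.
Unset Printing Implicit Defensive.

Import Order.TTheory GRing.Theory Num.Theory.
Import numFieldNormedType.Exports.

Local Open Scope classical_set_scope.
Local Open Scope ring_scope.

(* Points of R^n are row vectors 'rV[R]_n;
   R^(n + p + d) is 'rV[R]_(n + p + d), with the blocks x, y, z in this
   order, extracted by lsubmx and rsubmx. *)

Definition int_points (R : realType) (d : nat) : set 'rV[R]_d :=
  [set z | z \is a mxOver Num.int].
Arguments int_points R d : clear implicits.

Definition conv_hull (R : realType) (d : nat) (A : set 'rV[R]_d) :
    set 'rV[R]_d :=
  smallest (@convex_set R 'rV[R]_d) A.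

Definition proj_x (R : realType) (n p : nat) (A : set 'rV[R]_(n + p)) :
    set 'rV[R]_n :=
  [set lsubmx v | v in A].

Definition nat_embed (R : realType) (S : set nat) : set 'rV[R]_1 :=
  [set const_mx k%:R | k in S].
Arguments nat_embed R S : clear implicits.

(* The step a = 0 is allowed, in which case the progression is {b}. *)
Definition infinite_arith_progression (A : set nat) : Prop :=
  exists a b : nat, A = [set (a * m + b)%N | m in [set: nat]].

Definition rational_polyhedron (R : realType) (N : nat) (M : set 'rV[R]_N) :
    Prop :=
  exists (m : nat) (A : 'M[rat]_(N, m)) (b : 'rV[rat]_m),
    M = [set v | forall i : 'I_m, (v *m map_mx ratr A) 0 i <= ratr (b 0 i)].

Definition rational_MILP_representable (R : realType) (n : nat)
    (T : set 'rV[R]_n) : Prop :=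
  exists (p d : nat) (M : set 'rV[R]_(n + p + d)),
    rational_polyhedron M /\
    T = proj_x [set lsubmx v | v in
                 M `&` [set v | int_points R d (rsubmx v)]].

(* A family over C is a function on the whole of R^d; its values outside C
   are never used. *)
Definition convex_family (R : realType) (d N : nat) (C : set 'rV[R]_d)
    (A : 'rV[R]_d -> set 'rV[R]_N) : Prop :=
  (forall z, C z -> convex_set (A z)) /\
  (forall (z z' : 'rV[R]_d) (l : R), C z -> C z' -> 0 <= l <= 1 ->
     [set l *: x + (1 - l) *: x' | x in A z & x' in A z']
       `<=` A (l *: z + (1 - l) *: z')).

Definition closed_convex_family (R : realType) (d N : nat) (C : set 'rV[R]_d)
    (A : 'rV[R]_d -> set 'rV[R]_N) : Prop :=
  [/\ convex_family C A,
      forall z, C z -> closed (A z)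
    & forall (z_ : nat -> 'rV[R]_d) (x_ : nat -> 'rV[R]_N)
             (z : 'rV[R]_d) (x : 'rV[R]_N),
        z_ @ \oo --> z -> x_ @ \oo --> x ->
        (forall m, C (z_ m)) -> (forall m, A (z_ m) (x_ m)) ->
        C z -> A z x].

Definition MICP_representation (R : realType) (n d p : nat)
    (S : set 'rV[R]_n) (C : set 'rV[R]_d)
    (A : 'rV[R]_d -> set 'rV[R]_(n + p)) : Prop :=
  [/\ convex_set C,
      closed_convex_family C A
    & S = \bigcup_(z in C `&` int_points R d) proj_x (A z)].

Definition rationally_unbounded_convex (R : realType) (d : nat)
    (C : set 'rV[R]_d) : Prop :=
  [/\ convex_set C,
      ~ bounded_set C
    & forall L : 'M[rat]_d,
        let C' := [set v *m map_mx ratr L | v in C] in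
        bounded_set C' \/
        exists r : 'rV[R]_d,
          [/\ int_points R d r, r != 0
            & forall (x : 'rV[R]_d) (l : R),
                int_points R d x -> C' x -> 0 <= l -> C' (x + l *: r)]].

Definition rationally_unbounded_int (R : realType) (d : nat)
    (A : set 'rV[R]_d) : Prop :=
  [/\ A `<=` int_points R d,
      infinite_set A
    & exists I : set 'rV[R]_d,
        [/\ finite_set I, I `<=` A
          & rationally_unbounded_convex (conv_hull (A `\` I))]].

Definition rational_MICP_representable (R : realType) (n : nat)
    (S : set 'rV[R]_n) : Prop :=
  exists (d p : nat) (C : set 'rV[R]_d) (A : 'rV[R]_d -> set 'rV[R]_(n + p)),
    [/\ MICP_representation S C A,
        forall z, C z -> A z !=set0
      & bounded_set (C `&` int_points R d) \/
        rationally_unbounded_int (C `&` int_points R d)].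

(* Main.v *)
(* Each condition is equivalent to eventual periodicity: for some a > 0, every
   large n in S has n + a in S.

   For (a), every fibre over an integer point z of C projects to a single natural
   number f(z), and f respects lattice midpoints.  Let D be the convex hull of
   C /\ Z^d minus the finite exceptional set.  If L is an integer matrix through
   which f factors (up to a congruence) and L(D) is unbounded, rational
   unboundedness gives a lattice direction r of L(D).  The slope of f along r
   depends only on a congruence class: points of positive slope can be translated,
   and on the points of zero slope f factors through a matrix killing r as well.
   Each step kills a coordinate, and f takes finitely many values once L(D) is
   bounded.

   For (c), eliminate the continuous variables by Fourier-Motzkin and apply
   Dickson's lemma to the integer slacks of an unbounded sequence of solutions: the
   difference of two solutions with increasing slacks is a recession direction.

   Conversely, with one vertex e_i of a simplex for each progression, the points
   (t, e_i) of a (possibly non-closed) cone over the simplex encode s_i + a t. *)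

Require Import Defs.
From HB Require Import structures.
From mathcomp Require Import all_boot all_order all_algebra.
From mathcomp Require Import all_classical all_reals all_analysis.
From mathcomp Require Import zify ring lra.

Set Implicit Arguments.
Unset Strict Implicit.
Unset Printing Implicit Defensive.

Import Order.TTheory GRing.Theory Num.Theory.
Import numFieldNormedType.Exports.

Local Open Scope classical_set_scope.
Local Open Scope ring_scope.

(** * Eventually periodic sets of natural numbers *)

(** Only forward closure is asked: within each residue class modulo [a], membership is then
    eventually constant, which is the usual periodicity. *)
Definition eventually_periodic (S : set nat) : Prop :=
  exists a N : nat, (0 < a)%N /\ forall n, (N <= n)%N -> S n -> S (n + a)%N.

(** Normal form for the two constructions: one common step [a], base points [s i], and a flag [J i]
    telling whether [s i] starts a whole progression or stands alone. *)
Definition progression_form (S : set nat) : Prop :=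
  exists (a k : nat) (s : 'I_k -> nat) (J : 'I_k -> bool), (0 < a)%N /\
    forall n, S n <-> exists i m, n = (s i + a * m)%N /\ (J i \/ m = 0%N).

Lemma ord_unbounded_choice k (P : 'I_k -> nat -> Prop) :
  (forall i m n, (m <= n)%N -> P i m -> P i n) ->
  (forall i, exists n, P i n) -> exists n, forall i, P i n.
Proof.
move=> Pmono /choice[g Pg]; exists (\max_i g i)%N => i.
exact: Pmono (leq_bigmax i) (Pg i).
Qed.

Lemma finite_set_nat_bound (A : set nat) :
  finite_set A -> exists N, forall n, A n -> (n < N)%N.
Proof.
move=> /finite_seqP[s ->]; exists (\max_(i <- s) i).+1 => n /= ns.
by rewrite ltnS (@leq_bigmax_seq _ s xpredT id).
Qed.

(** The product of the nonzero steps is a common period. Progressions of step 0 are singletons and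
    fall below the threshold [N1]. *)
Lemma eventually_periodic_unions (S : set nat) (k : nat) (A0 : set nat)
    (A : 'I_k -> set nat) :
  finite_set A0 -> (forall i, infinite_arith_progression (A i)) ->
  S = A0 `|` \bigcup_(i in [set: 'I_k]) A i ->
  eventually_periodic S.
Proof.
move=> /finite_set_nat_bound[N0 hN0] /choice[a /choice[b hA]] ->.
have [N1 hN1] : exists N, forall i, (b i < N)%N.
  by apply: ord_unbounded_choice => [i m n mn|i]; [move/leq_trans; apply|exists (b i).+1].
exists (\prod_i (if a i == 0%N then 1 else a i))%N, (maxn N0 N1); split.
  by apply: prodn_gt0 => i; case: eqP => // /eqP; rewrite lt0n.
move=> n; rewrite geq_max => /andP[n0 n1] [/hN0|[i _]]; first by rewrite ltnNge n0.
rewrite (hA i) => -[m _ mn]; right; exists i => //; rewrite (hA i).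
have := hN1 i; have [ai0|ai0] := eqVneq (a i) 0%N.
  by move: n1; rewrite -mn ai0 mul0n add0n leqNgt => /negbTE ->.
move=> _; rewrite (bigD1 i) //= (negbTE ai0) -mn.
set q := (\prod_(j < k | _) _)%N.
by exists (m + q)%N => //; rewrite mulnDr; lia.
Qed.

(** The period becomes the common step. Finitely many base points suffice because there are only [a]
    residue classes. *)
Lemma eventually_periodic_form (S : set nat) :
  eventually_periodic S -> progression_form S.
Proof.
move=> [a [N [a0 SN]]].
have SNm n m : (N <= n)%N -> S n -> S (n + a * m)%N.
  move=> Nn Sn; elim: m => [|m IH]; first by rewrite muln0 addn0.
  by rewrite mulnS [(a + _)%N]addnC addnA; apply: SN => //; lia.
(* in each residue class, everything beyond one chosen element is reached from it *)
have [N' hN'] : exists N', forall c : 'I_a, forall n, n = c %[mod a] -> (N <= n)%N -> S n ->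
    exists j m, [/\ (j < N')%N, (N <= j)%N, S j & n = (j + a * m)%N].
  apply: ord_unbounded_choice => [c m n mn H q qc Nq Sq|c].
    by have [j [l [jm Nj Sj ->]]] := H q qc Nq Sq; exists j, l; split=> //; lia.
  have [[n0 [n0c Nn0 Sn0]]|no] := pselect (exists n, [/\ n = c %[mod a], (N <= n)%N & S n]); last first.
    by exists 0%N => n nc Nn Sn; case: no; exists n.
  exists n0.+1 => n nc Nn Sn; have [n0n|nn0] := leqP n0 n; last first.
    by exists n, 0%N; split=> //; lia.
  have : n == n0 %[mod a] by rewrite nc n0c.
  rewrite eqn_mod_dvd // => /dvdnP[m mE]; exists n0, m; split=> //; lia.
(* The base points are all elements of [S] below [M]; those that are at least [N] are flagged, since
   [SNm] applies to them. *)
pose M := maxn N N'; pose E := [pred j : 'I_M | `[< S j >]].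
exists a, #|E|, (fun i : 'I_#|E| => nat_of_ord (enum_val i)),
  (fun i : 'I_#|E| => N <= enum_val i)%N; split => // n; split.
  move=> Sn; have [Nn|nN] := leqP N n.
    have [j [m [jN' Nj Sj ->]]] := hN' (Ordinal (ltn_pmod n a0)) n (esym (modn_mod _ _)) Nn Sn.
    have jM : (j < M)%N by rewrite /M; lia.
    have jin : Ordinal jM \in E by rewrite unfold_in /=; exact/asboolP.
    exists (enum_rank_in jin (Ordinal jM)). exists m; rewrite enum_rankK_in //=.
    by split=> //; left.
  have jM : (n < M)%N by rewrite /M; lia.
  have jin : Ordinal jM \in E by rewrite unfold_in /=; exact/asboolP.
  exists (enum_rank_in jin (Ordinal jM)), 0%N; rewrite enum_rankK_in //=.
  by rewrite muln0 addn0; split => //; right.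
move=> [i [m [-> im]]].
have Si : S (enum_val i) by have := enum_valP i; rewrite unfold_in /= => /asboolP.
by case: im => [|->]; [move/SNm; apply|rewrite muln0 addn0].
Qed.

(** An unflagged base point becomes a progression of step 0, so [A0] is taken empty. *)
Lemma progression_form_unions (S : set nat) :
  progression_form S ->
  exists (k : nat) (A0 : set nat) (A : 'I_k -> set nat),
      [/\ finite_set A0,
          forall i, infinite_arith_progression (A i)
        & S = A0 `|` \bigcup_(i in [set: 'I_k]) A i].
Proof.
move=> [a [k [s [J [a0 hS]]]]].
exists k, set0, (fun i => [set ((if J i then a else 0) * m + s i)%N | m in [set: nat]]).
split=> //; first by move=> i; exists (if J i then a else 0%N), (s i).
rewrite set0U; apply/seteqP; split=> n.
  move=> /hS[i [m [-> im]]]; exists i => //; exists m => //.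
  by case: ifP => Ji; [lia|case: im => [|->]; rewrite ?Ji ?muln0 ?addn0].
move=> [i _ [m _ <-]]; apply/hS; exists i.
by case: ifP => Ji; [exists m|exists 0%N]; (split; [lia|]); [left|right].
Qed.

(** * Convex sets and integer rows *)

Section Convexity.
Variables (R : realType) (d : nat).
Implicit Types A B : set 'rV[R]_d.

(** Trades the interval-typed coefficient of [convex_set] for a real number with explicit bounds. *)
Lemma convex_setP A :
  convex_set A <->
  forall (x y : 'rV[R]_d) (l : R), 0 <= l <= 1 -> A x -> A y ->
    A (l *: x + (1 - l) *: y).
Proof.
split => [cA x y l /andP[l0 l1] Ax Ay|cA x y l].
  have l01 : Itv.spec (@Itv.num_sem R) (Itv.Real `[0%Z, 1%Z]%R) l.
    by rewrite /= /Itv.num_sem /= in_itv /= l0 l1 ger0_real.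
  have := cA x y (Itv.Def l01); rewrite !inE => /(_ Ax Ay).
  by [].
rewrite !inE => Ax Ay; apply: cA => //.
by rewrite ge0 le1.
Qed.

Lemma conv_hull_convex A : convex_set (conv_hull A).
Proof.
apply/convex_setP => x y l l01 Ax Ay C [cC AC].
by move/convex_setP: (cC); apply => //; [exact: Ax|exact: Ay].
Qed.

Lemma sub_conv_hull A : A `<=` conv_hull A.
Proof. exact: sub_smallest. Qed.

Lemma conv_hull_min A B : convex_set B -> A `<=` B -> conv_hull A `<=` B.
Proof. by move=> cB AB x; apply. Qed.

Lemma bounded_rowP A :
  bounded_set A <->
  exists M : R, forall x, A x -> forall j, `|x 0 j| <= M.
Proof.
split=> [/pinfty_ex_gt0[M _ AM]|[M AM]].
  exists M => x Ax j; apply: le_trans (AM x Ax).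
  rewrite [leRHS]/Num.Def.normr/= mx_normrE.
  by apply/bigmax_geP; right => /=; exists (0, j).
rewrite /= /bounded_near; near=> K => x Ax /=.
apply: (@le_trans _ _ `|M|); last by near: K; exact: nbhs_pinfty_ge.
rewrite [leLHS]/Num.Def.normr/= mx_normrE.
apply/bigmax_leP; split => //= -[i j] _ /=.
by rewrite (ord1 i) (le_trans (AM x Ax j)) // ler_norm.
Unshelve. all: by end_near. Qed.

End Convexity.

Lemma add_rowE (V : nmodType) n (u v : 'rV[V]_n) i : (u + v) 0 i = u 0 i + v 0 i.
Proof. by rewrite mxE. Qed.

Lemma scale_rowE (K : pzRingType) n (c : K) (u : 'rV[K]_n) i : (c *: u) 0 i = c * u 0 i.
Proof. by rewrite mxE. Qed.

Lemma opp_rowE (V : zmodType) n (u : 'rV[V]_n) i : (- u) 0 i = - u 0 i.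
Proof. by rewrite mxE. Qed.

Lemma sub_rowE (V : zmodType) n (u v : 'rV[V]_n) i : (u - v) 0 i = u 0 i - v 0 i.
Proof. by rewrite !mxE. Qed.

(** The product of all denominators of the entries serves as [c]. *)
Lemma rat_mx_common_denominator m n (E : 'M[rat]_(m, n)) :
  exists (c : nat) (U : 'M[int]_(m, n)), (0 < c)%N /\ map_mx intr U = c%:R *: E.
Proof.
pose c := (\prod_i \prod_j absz (denq (E i j)))%N.
have cP i j : exists u : int, u%:~R = c%:R * E i j :> rat.
  have [q ->] : exists q, c = (q * absz (denq (E i j)))%N.
    by rewrite /c (bigD1 i) //= (bigD1 j) //= -mulnA mulnC; eexists.
  exists (q%:Z * numq (E i j)); rewrite intrM natrM -mulrA; congr (_ * _).
  by rewrite natr_absz normr_denq numqE mulrC.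
have [u uP] : {u : 'I_m -> 'I_n -> int | forall i j, (u i j)%:~R = c%:R * E i j :> rat}.
  by exists (fun i j => projT1 (cid (cP i j))) => i j; exact: projT2 (cid (cP i j)).
exists c, (\matrix_(i, j) u i j); split.
  by apply: prodn_gt0 => i; apply: prodn_gt0 => j; rewrite absz_gt0 denq_neq0.
by apply/matrixP => i j; rewrite !mxE uP.
Qed.

Lemma map_intr_inj (K : numDomainType) m n :
  injective (fun L : 'M[int]_(m, n) => map_mx intr L : 'M[K]_(m, n)).
Proof.
by move=> A B /matrixP AB; apply/matrixP => i j; have := AB i j; rewrite !mxE => /intr_inj.
Qed.

Lemma map_intrMn (K : numDomainType) m n (L : 'M[int]_(m, n)) k :
  map_mx intr (L *+ k) = map_mx intr L *+ k :> 'M[K]_(m, n).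
Proof. by apply/matrixP => i j; rewrite mxE !mulmxnE mxE rmorphMn. Qed.

Lemma mulmxMnl (K : pzRingType) m n p (A : 'M[K]_(m, n)) (B : 'M[K]_(n, p)) k :
  (A *+ k) *m B = (A *m B) *+ k.
Proof. by rewrite -scaler_nat -scalemxAl scaler_nat. Qed.

(** Division-free projection along [r]: a row [a] goes to [r 0 i *: a - a 0 i *: r], so [r] is
    killed and coordinate [i] of every image vanishes. *)
Definition elim_mx (K : pzRingType) n (r : 'rV[K]_n) (i : 'I_n) : 'M[K]_n :=
  (r 0 i)%:M - delta_mx i 0 *m r.

Lemma mul_elim_mx (K : comPzRingType) m n (A : 'M[K]_(m, n)) (r : 'rV[K]_n) i :
  A *m elim_mx r i = r 0 i *: A - col i A *m r.
Proof. by rewrite mulmxBr mul_mx_scalar mulmxA -colE. Qed.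

Lemma mul_row_elim_mx (K : comPzRingType) n (a : 'rV[K]_n) (r : 'rV[K]_n) i :
  a *m elim_mx r i = r 0 i *: a - a 0 i *: r.
Proof. by rewrite mul_elim_mx [col i a]mx11_scalar mul_scalar_mx mxE. Qed.

Lemma map_elim_mx (K : pzRingType) n (r : 'rV[int]_n) i :
  map_mx (intr : int -> K) (elim_mx r i) = elim_mx (map_mx intr r) i.
Proof. by rewrite map_mxB map_scalar_mx map_mxM map_delta_mx /elim_mx mxE. Qed.

Section IntegerRows.
Variable R : realType.

Lemma map_intr_ratr m n (L : 'M[int]_(m, n)) :
  map_mx intr L = map_mx ratr (map_mx intr L : 'M[rat]_(m, n)) :> 'M[R]_(m, n).
Proof. by apply/matrixP => i j; rewrite !mxE ratr_int. Qed.

(** Solvability of a linear system does not change under field extension, so a real solution yields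
    a rational one; its denominators are then cleared. *)
Lemma integral_solution m n (L : 'M[int]_(m, n)) (r : 'rV[int]_n) (v : 'rV[R]_m) :
  v *m map_mx intr L = map_mx intr r ->
  exists (c : nat) (u : 'rV[int]_m), (0 < c)%N /\ u *m L = r *+ c.
Proof.
move=> vL.
have /submxP[E rE] : (map_mx intr r <= (map_mx intr L : 'M[rat]_(m, n)))%MS.
  rewrite -(map_submx (ratr : {rmorphism rat -> R})) -!map_intr_ratr.
  by apply/submxP; exists v.
have [c [u [c0 uE]]] := rat_mx_common_denominator E.
exists c, u; split=> //; apply: (@map_intr_inj rat).
by rewrite map_mxM uE -scalemxAl -rE map_intrMn scaler_nat.
Qed.

End IntegerRows.

(** * Congruence classes of integer rows *)

Section Congruence.
Variable d : nat.
Implicit Types x y z : 'rV[int]_d.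

Definition congr_row (N : nat) x y : Prop := exists v : 'rV[int]_d, x = y + v *+ N.

Lemma congr_row_refl N x : congr_row N x x.
Proof. by exists 0; rewrite mul0rn addr0. Qed.

Lemma congr_row_sym N x y : congr_row N x y -> congr_row N y x.
Proof. by move=> [v ->]; exists (- v); rewrite mulNrn addrK. Qed.

Lemma congr_row_trans N x y z : congr_row N x y -> congr_row N y z -> congr_row N x z.
Proof. by move=> [v ->] [w ->]; exists (w + v); rewrite mulrnDl addrA. Qed.

Lemma congr_row_mull N M x y : congr_row (N * M) x y -> congr_row M x y.
Proof. by move=> [v ->]; exists (v *+ N); rewrite mulrnA. Qed.

Lemma congr_row_mulr N M x y : congr_row (N * M) x y -> congr_row N x y.
Proof. by rewrite mulnC; exact: congr_row_mull. Qed.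

Lemma finite_congr_row (N : nat) : (0 < N)%N ->
  exists h : 'rV[int]_d -> {ffun 'I_d -> 'I_N}, forall x y, h x = h y -> congr_row N x y.
Proof.
case: N => // N _.
exists (fun x => [ffun i => inord (absz (modz (x 0 i) N.+1%:Z))]) => x y /ffunP hxy.
exists (\row_i divz ((x - y) 0 i) N.+1%:Z); apply/rowP => i; rewrite !mxE.
have xi (z : int) : (absz (z %% N.+1%:Z)%Z < N.+1)%N.
  by have := ltz_pmod z (isT : 0 < N.+1%:Z); have := @modz_ge0 z N.+1%:Z isT; lia.
have := hxy i; rewrite !ffunE => /(congr1 val); rewrite /= !inordK //.
have := divz_eq (x 0 i - y 0 i) N.+1; have := @modz_ge0 (x 0 i) N.+1%:Z isT.
have := @modz_ge0 (y 0 i) N.+1%:Z isT => y0 x0 e1 e2.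
have : modz (x 0 i) N.+1%:Z = modz (y 0 i) N.+1%:Z by lia.
move/eqP; rewrite eqz_mod_dvd => /divzK; rewrite mulmxnE !mxE => e3.
by rewrite -mulr_natr natz e3 subrKC.
Qed.

End Congruence.

(** With [k] at least the absolute value of [K], entries of bounded rows differ by at most [2 * k],
    so congruence modulo [2 * k + 1] forces equality. *)
Lemma bounded_row_code (R : realType) d (K : R) :
  exists (I : finType) (h : 'rV[int]_d -> I), forall x y,
    (forall j, `|map_mx intr x 0 j| <= K) -> (forall j, `|map_mx intr y 0 j| <= K) ->
    h x = h y -> x = y.
Proof.
pose k := Num.bound `|K|.
have k0 : (0 < 2 * k + 1)%N by rewrite addn1.
have [h hh] := finite_congr_row d k0.
exists {ffun 'I_d -> 'I_(2 * k + 1)}, h => x y xK yK /hh[v xE].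
have small (z : 'rV[int]_d) j : (forall j, `|map_mx intr z 0 j| <= K) -> (absz (z 0%R j) <= k)%N.
  move=> /(_ j); rewrite mxE -(ler_nat R) natr_absz -intr_norm => zK.
  by rewrite (le_trans zK (le_trans (ler_norm _) (ltW (archi_boundP _)))).
apply/rowP => j; have := small _ j xK; have := small _ j yK; rewrite xE mxE mulmxnE.
move: (y 0 j) (v 0 j) => a b; rewrite -mulr_natr natz => ha hab.
have [->|b0] := eqVneq b 0; first by rewrite mul0r addr0.
have : (2 * k + 1 <= absz b * (2 * k + 1))%N by rewrite leq_pmull ?absz_gt0.
have := abszM b (2 * k + 1)%N; rewrite [absz (2 * k + 1)%N]absz_nat => <-; lia.
Qed.

Lemma finite_classes_bound (T : Type) (I : finType) (h : T -> I) (g : T -> nat) (X : set T) :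
  (forall x y, X x -> X y -> h x = h y -> g x = g y) ->
  exists G, forall x, X x -> (g x <= G)%N.
Proof.
move=> hg.
have /choice[G hG] : forall i, exists n, forall x, X x -> h x = i -> (g x <= n)%N.
  move=> i; have [[x [Xx hx]]|no] := pselect (exists x, X x /\ h x = i).
    by exists (g x) => y Xy hy; rewrite (hg y x) // hx hy.
  by exists 0%N => x Xx hx; case: no; exists x.
exists (\max_i G i)%N => x Xx.
exact: leq_trans (hG (h x) x Xx erefl) (leq_bigmax (h x)).
Qed.

(** The relation makes the increments constant. A negative increment would make [phi] negative at
    index [(phi 0).+1], so the slope is natural. *)
Lemma midpoint_affine_nat (phi : nat -> nat) :
  (forall m, phi m + phi m.+2 = 2 * phi m.+1)%N ->
  exists g, forall m, phi m = (phi 0 + m * g)%N.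
Proof.
move=> H; pose e : int := (phi 1)%:Z - (phi 0)%:Z.
have key m : (phi m)%:Z = (phi 0)%:Z + m%:Z * e /\ (phi m.+1)%:Z = (phi 0)%:Z + m.+1%:Z * e.
  elim: m => [|m [IH1 IH2]]; first by rewrite /e; split; ring.
  split=> //; have := H m; nia.
have e0 : 0 <= e.
  rewrite leNgt; apply/negP => e0; have [h _] := key (phi 0).+1.
  have : (phi 0).+1%:Z * e <= (phi 0).+1%:Z * -1 by rewrite ler_pM2l; lia.
  by rewrite mulrN1 -(lerD2l (phi 0)%:Z) -h; lia.
exists (absz e) => m; have [h _] := key m.
  by apply/eqP; rewrite -eqz_nat PoszD PoszM gez0_abs // h.
Qed.

(** * Midpoint-affine functions on the lattice points of a convex set *)

Section MidpointAffine.
Variables (R : realType) (d : nat) (D : set 'rV[R]_d) (f : 'rV[int]_d -> nat).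

Local Notation toR := (map_mx (intr : int -> R)).

Let P : set 'rV[int]_d := [set x | D (toR x)].

Hypothesis D_convex : convex_set D.
Hypothesis f_mid : forall x y z, P x -> P y -> P z -> x + y = z + z ->
  (f x + f y = 2 * f z)%N.
Hypothesis D_ray : forall L : 'M[int]_d,
  (exists K : R, forall w, D w -> forall j, `|(w *m toR L) 0 j| <= K) \/
  exists r : 'rV[int]_d, r != 0 /\
    forall w (l : R), D w -> 0 <= l -> exists w', D w' /\ w' *m toR L = w *m toR L + l *: toR r.

(* Modulo [ker L] every point of [D] over a lattice point is a lattice point of [D],
   in any prescribed congruence class, and [f] factors on [X] through [L] and the
   congruence class modulo [N]. *)
Let factors (L : 'M[int]_d) (N : nat) (X : set 'rV[int]_d) : Prop :=
  [/\ (0 < N)%N,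
      forall (M : nat) w q, (0 < M)%N -> D w -> w *m toR L = toR q *m toR L ->
        exists y, [/\ P y, y *m L = q *m L & congr_row M y q],
      X `<=` P,
      forall x y, X x -> X y -> x *m L = y *m L -> congr_row N x y -> f x = f y
    & forall x y, X x -> P y -> congr_row N y x -> X y].

(** The translated point may leave [X]. The threshold [K] covers the case where [f] is bounded on
    [X], and the quantified [m] lets [a] be replaced by a multiple. *)
Let translates (X : set 'rV[int]_d) : Prop :=
  exists a K : nat, (0 < a)%N /\ forall x m, X x -> (K <= f x)%N ->
    exists2 y, P y & f y = (f x + m * a)%N.

Section Step.
Variables (L : 'M[int]_d) (N : nat) (X : set 'rV[int]_d) (u r : 'rV[int]_d).
Hypothesis fLX : factors L N X.
Hypothesis uL : u *m L = r.
Hypothesis r_ray : forall w (l : R), D w -> 0 <= l ->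
  exists w', D w' /\ w' *m toR L = w *m toR L + l *: toR r.

(** In the image, [y] lies [m] steps of length [2 * N] along [r] from [x]. The factor 2 keeps
    midpoints integral and congruent modulo [N]. *)
Let above x m y := [/\ X y, congr_row (2 * N) y x & y *m L = x *m L + r *+ (m * (2 * N))].

(** The ray reaches the wanted image point, [x] plus a multiple of [u] is an integer preimage of it,
    and the lifting clause of [factors] moves that preimage into [D]. *)
Lemma above_exists x m : X x -> exists y, above x m y.
Proof.
have [N0 abs XP _ Xcl] := fLX => Xx.
have [w' [Dw' w'E]] := r_ray (XP _ Xx) (ler0n R (m * (2 * N))).
have [||y [Py yL yx]] := abs (2 * N)%N w' (x + u *+ (m * (2 * N))) _ Dw'.
- by rewrite muln_gt0.
- by rewrite w'E -[RHS]map_mxM mulmxDl mulmxMnl uL map_mxD map_mxM map_intrMn scaler_nat.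
have yx2 : congr_row (2 * N) y x.
  by apply: congr_row_trans yx _; exists (u *+ m); rewrite mulrnA.
exists y; split=> //; last by rewrite yL mulmxDl mulmxMnl uL.
by apply: Xcl Xx Py _; exact: congr_row_mull yx2.
Qed.

Lemma midpoint_exists x y : X x -> X y -> congr_row (2 * N) x y ->
  exists t, [/\ X t, x + y = t + t & congr_row N t y].
Proof.
have [N0 _ XP fX Xcl] := fLX => Xx Xy [v xE].
pose t := y + v *+ N.
have tE : x + y = t + t.
  by rewrite xE mul2n -addnn mulrnDr /t [RHS]addrACA [LHS]addrAC.
have Pt : P t.
  move/convex_setP: D_convex => /(_ (toR x) (toR y) 2^-1) H.
  have half : (1 - 2^-1 : R) = 2^-1 by lra.
  rewrite /P /= (_ : toR t = 2^-1 *: toR x + (1 - 2^-1) *: toR y).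
    by apply: H; [lra|exact: XP|exact: XP].
  rewrite half -scalerDr -map_mxD tE map_mxD -mulr2n -(scaler_nat 2 (toR t)) scalerA.
  by rewrite mulVf ?scale1r ?pnatr_eq0.
by exists t; split=> //; [apply: Xcl Xy Pt _; exists v|exists v].
Qed.

(** Here [z] is a midpoint only after applying [L]. It shares its image and its class modulo [N]
    with the true midpoint, hence also its value. *)
Lemma above_mid x y z : X x -> X y -> X z -> congr_row (2 * N) x y -> congr_row N z y ->
  x *m L + y *m L = z *m L + z *m L -> (f x + f y = 2 * f z)%N.
Proof.
have [N0 _ XP fX Xcl] := fLX => Xx Xy Xz xy zy e.
have [t [Xt tE ty]] := midpoint_exists Xx Xy xy.
rewrite (f_mid (XP _ Xx) (XP _ Xy) (XP _ Xt) tE); congr (2 * _)%N.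
apply: fX => //; last exact: congr_row_trans ty (congr_row_sym zy).
have : (t *m L) *+ 2 = (z *m L) *+ 2 by rewrite !mulr2n -mulmxDl -tE mulmxDl e.
move=> /rowP te; apply/rowP => i; by have := te i; rewrite !mulmxnE => /eqP; rewrite eqrMn2r => /eqP.
Qed.

(** The value of [f] does not depend on the point chosen [m] steps above [x], and these values
    satisfy the midpoint relation in [m]. *)
Lemma above_slope x : X x -> exists g, forall m y, above x m y -> f y = (f x + m * g)%N.
Proof.
move=> Xx; have [_ _ _ fX _] := fLX.
have [Y hY] := choice (fun m => above_exists m Xx).
have phiE m y : above x m y -> f y = f (Y m).
  move=> [Xy yx yL]; have [XY Yx YL] := hY m; apply: fX => //; first by rewrite yL YL.
  by apply: congr_row_mull (congr_row_trans yx (congr_row_sym Yx)).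
have [m|g hg] := @midpoint_affine_nat (fun m => f (Y m)).
  have [X0 c0 e0] := hY m; have [X1 c1 e1] := hY m.+1; have [X2 c2 e2] := hY m.+2.
  apply: above_mid => //.
  - exact: congr_row_trans c0 (congr_row_sym c2).
  - exact: congr_row_mull (congr_row_trans c1 (congr_row_sym c2)).
  - by rewrite e0 e1 e2 !addrA !(addrAC _ _ (x *m L)) -!addrA -!mulrnDr; congr (_ + (_ + _ *+ _)); lia.
exists g => m y /phiE ->; rewrite hg; congr (_ + _)%N.
by apply/esym/phiE; split=> //; [exact: congr_row_refl|rewrite mul0n mulr0n addr0].
Qed.

(** One round of elimination: points of positive slope are translated along [r], and those of slope
    0 form [X']. The number of nonzero columns is the termination measure. *)
Lemma above_step : r != 0 ->
  exists (L' : 'M[int]_d) (N' : nat) (X' : set 'rV[int]_d),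
  [/\ factors L' N' X', translates X' -> translates X &
   [pred i | col i L' != 0] \proper [pred i | col i L != 0]].
Proof.
move=> r0; have [N0 abs XP fX Xcl] := fLX.
have /choice[g hg] : forall x, exists g, X x -> forall m y, above x m y -> f y = (f x + m * g)%N.
  move=> x; have [Xx|nX] := pselect (X x); last by exists 0%N.
  by have [g hg] := above_slope Xx; exists g.
(* Two steps above [x] paired with [y], and two steps above [y] paired with [x], have the same
   midpoint after [L]: one step above [t]. Comparing both relations equates the slopes. *)
have g_class x y : X x -> X y -> congr_row (2 * N) x y -> g x = g y.
  move=> Xx Xy xy; have [t [Xt tE ty]] := midpoint_exists Xx Xy xy.
  have tLE : x *m L + y *m L = t *m L + t *m L by rewrite -!mulmxDl tE.
  have [a ha] := above_exists 2 Xx; have [b hb] := above_exists 2 Xy.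
  have [c hc] := above_exists 1 Xt.
  have [Xa ax aL] := ha; have [Xb yb bL] := hb; have [Xc tc cL] := hc.
  have cy := congr_row_trans (congr_row_mull tc) ty.
  have : (f a + f y = 2 * f c)%N.
    apply: above_mid => //; first exact: congr_row_trans ax xy.
    by rewrite aL cL addrAC tLE [RHS]addrACA -mulrnDr mul1n mul2n addnn.
  have : (f b + f x = 2 * f c)%N.
    apply: above_mid => //.
    + exact: congr_row_trans yb (congr_row_sym xy).
    + by apply: congr_row_trans cy _; exact: congr_row_mull (congr_row_sym xy).
    + by rewrite bL cL addrAC [_ + x *m L]addrC tLE [RHS]addrACA -mulrnDr mul1n mul2n addnn.
  by rewrite (hg x Xx _ _ ha) (hg y Xy _ _ hb); lia.
have [i ri] := rV0Pn _ r0.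
have N20 : (0 < 2 * N)%N by rewrite muln_gt0.
(* The factor [absz (r 0 i)] in the modulus ensures that points with equal new image and class
   differ, after [L], by an integer number of steps [2 * N] along [r]. *)
exists (L *m elim_mx r i), (2 * N * absz (r 0%R i))%N, [set x | X x /\ g x = 0%N]; split.
- split.
  + by rewrite muln_gt0 N20 absz_gt0.
  + move=> M w q M0 Dw; rewrite map_mxM map_elim_mx !mulmxA !mul_row_elim_mx => e.
    pose s := w *m toR L - toR q *m toR L.
    have riR : toR r 0 i != 0 by rewrite mxE intr_eq0.
    pose tau := s 0 i / toR r 0 i.
    have wE : w *m toR L = toR q *m toR L + tau *: toR r.
      have sE : s = tau *: toR r.
        have s0 : s 0 i = (w *m toR L) 0 i - (toR q *m toR L) 0 i.
          by rewrite /s mxE [X in _ + X]mxE.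
        apply: (scalerI riR); rewrite scalerA [_ * tau]mulrC divfK // s0 /s scalerBr scalerBl.
        move/(canRL (subrK _)): e => ->.
        by rewrite [LHS]addrC addrA addKr addrC.
      by rewrite -sE /s subrKC.
    (* The image of [w] is that of [q] shifted by the real multiple [tau] of [r]. Moving along the
       ray up to the integer [M * m] reaches the image of [q + u *+ (M * m)], which agrees with [q]
       modulo [M] and under the new matrix. *)
    pose m := Num.bound `|tau|.
    have tau_le : 0 <= (M * m)%:R - tau.
      rewrite subr_ge0 (le_trans (ler_norm _)) // (le_trans (ltW (archi_boundP (normr_ge0 tau)))) //.
      by rewrite ler_nat leq_pmull.
    have [w' [Dw' w'E]] := r_ray Dw tau_le.
    have [|y [Py yL yq]] := abs M w' (q + u *+ (M * m)) M0 Dw'.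
      rewrite w'E wE map_mxD mulmxDl map_intrMn mulmxMnl -[toR u *m _]map_mxM uL.
      rewrite -addrA -scalerDl subrKC.
      by rewrite scaler_nat.
    exists y; split=> //.
      rewrite !mulmxA yL mulmxDl mulmxMnl uL mulmxDl mulmxMnl.
      by rewrite [r *m _]mul_row_elim_mx subrr mul0rn addr0 mul_row_elim_mx.
    by apply: congr_row_trans yq _; exists (u *+ m); rewrite mulnC mulrnA.
  + by move=> x [/XP].
  + have key x y k : X x -> X y -> g y = 0%N -> congr_row (2 * N) x y ->
      x *m L = y *m L + r *+ (k * (2 * N)) -> f x = f y.
      by move=> Xx Xy gy xy xL; rewrite (hg y Xy k x) // gy muln0 addn0.
    move=> x y [Xx gx] [Xy gy]; rewrite !mulmxA !mul_row_elim_mx => e xy.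
    have xy2 := congr_row_mulr xy; have [v xE] := xy.
    pose s := v *m L.
    have sE : r 0 i *: s = s 0 i *: r.
      move: e; rewrite xE mulmxDl mulmxMnl -/s.
      have : (2 * N * absz (r 0%R i))%:R != 0 :> int.
        by rewrite pnatr_eq0 -lt0n muln_gt0 N20 absz_gt0.
      move: (y *m L) s => Y s n0 /rowP e; apply/rowP => k.
      have := e k.
      rewrite !mxE !mulmxnE -(mulr_natr (s 0 k)) -(mulr_natr (s 0 i)).
      move: (_%:R) n0 => n n0 ek; apply: (mulIf n0); apply/eqP; rewrite -subr_eq0; apply/eqP.
      have -> : r 0 i * s 0 k * n - s 0 i * r 0 k * n =
        (r 0 i * (Y 0 k + s 0 k * n) - (Y 0 i + s 0 i * n) * r 0 k) -
        (r 0 i * Y 0 k - Y 0 i * r 0 k) by ring.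
      by rewrite ek subrr.
    have [z zE] : exists z : int, s *+ absz (r 0%R i) = z *: r.
      have [e1|e1] : (absz (r 0%R i))%:Z = r 0 i \/ (absz (r 0%R i))%:Z = - r 0 i by lia.
        by exists (s 0 i); rewrite -scaler_nat natz e1 sE.
      by exists (- s 0 i); rewrite -scaler_nat natz e1 !scaleNr sE.
    have xyL : x *m L = y *m L + (z *: r) *+ (2 * N).
      by rewrite xE mulmxDl mulmxMnl -/s mulnC mulrnA zE.
    (* For [z] nonnegative, [x] lies [k] steps above [y]; for [z] negative, [y] lies [k.+1] steps
       above [x]. Slope 0 gives equal values in both cases. *)
    case: z {zE} xyL => k xyL; first by apply: (key _ _ k) => //; rewrite xyL -natz scaler_nat -mulrnA.
    apply/esym/(key _ _ k.+1) => //; first exact: congr_row_sym.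
    by rewrite xyL NegzE scaleNr -natz scaler_nat mulNrn -mulrnA subrK.
  + move=> x y [Xx gx] Py yx.
    have yx2 := congr_row_mulr yx.
    have Xy := Xcl _ _ Xx Py (congr_row_mull yx2).
    by split=> //; rewrite (g_class y x).
- move=> [a [K [a0 H]]].
  have [h hh] := finite_congr_row d N20.
  have [G hG] : exists G, forall x, X x -> (g x <= G)%N.
    by apply: (@finite_classes_bound _ _ h) => x y Xx Xy /hh; exact: g_class.
  (* Slopes are bounded by [G], so its factorial is a multiple of every positive slope, while the
     factor [a] serves the points of slope 0. *)
  exists (a * G`!)%N, K; split; first by rewrite muln_gt0 a0 fact_gt0.
  move=> x m Xx Kx; have [gx|gx] := posnP (g x).
    have [||y Py fy] := H x (m * G`!)%N => //.
    by exists y => //; rewrite fy -mulnA [(_ * a)%N]mulnC.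
  have /dvdnP[c ->] : (g x %| G`!)%N by apply: dvdn_fact; rewrite gx hG.
  have [y hy] := above_exists (m * a * c) Xx.
  have [Xy _ _] := hy; exists y; first exact: XP.
  by rewrite (hg x Xx _ _ hy) !mulnA.
(* Since [r] is a combination of the rows of [L], it vanishes wherever a column of [L] does. So zero
   columns persist, and column [i], nonzero in [L], becomes zero. *)
- have rE j : r 0 j = (u *m col j L) 0 0 by rewrite colE mulmxA uL -colE mxE.
  apply/properP; split.
    apply/fintype.subsetP => j; rewrite !inE; apply: contra => /eqP Lj.
    apply/eqP/colP => k.
    have rj : r 0 j = 0.
      by rewrite rE Lj mulmx0 mxE.
    have Lkj : L k j = 0 by have := congr1 (fun c : 'cV_d => c k 0) Lj; rewrite !mxE.
    by rewrite mul_elim_mx !mxE big_ord1 !mxE Lkj rj !mulr0 subrr.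
  exists i; rewrite !inE.
    apply: contraNneq ri => Li.
    by rewrite rE Li mulmx0 mxE.
  apply/negPn/eqP/colP => k; rewrite mul_elim_mx !mxE big_ord1 !mxE; ring.
Qed.

End Step.

(** Bounded images and classes modulo [N] leave finitely many values of [f] on [X], and a threshold
    above all of them makes the claim vacuous. *)
Lemma factors_bounded L N X : factors L N X ->
  (exists K : R, forall w, D w -> forall j, `|(w *m toR L) 0 j| <= K) -> translates X.
Proof.
move=> [N0 _ XP fX _] [K DK].
have [h hh] := finite_congr_row d N0; have [I [h' hh']] := bounded_row_code d K.
have DK' z j : X z -> `|toR (z *m L) 0 j| <= K by rewrite map_mxM => /XP/DK.
have [G hG] : exists G, forall x, X x -> (f x <= G)%N.
  apply: (@finite_classes_bound _ _ (fun x => (h x, h' (x *m L)))) => x y Xx Xy [/hh xy hxy].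
  by apply: fX => //; apply: hh' hxy => j; exact: DK'.
exists 1%N, G.+1; split=> // x m Xx Gx.
by have := hG x Xx; rewrite leqNgt Gx.
Qed.

Lemma factors_translates n (L : 'M[int]_d) N X : (#|[pred i | col i L != 0%R]| < n)%N ->
  factors L N X -> translates X.
Proof.
elim: n L N X => // n IH L N X Ln fLX.
have [[x0 Xx0]|X0] := pselect (X !=set0); last first.
  by exists 1%N, 0%N; split=> // x m Xx; case: X0; exists x.
have [|[r [r0 r_ray]]] := D_ray L; first exact: factors_bounded fLX.
have [N0 _ XP _ _] := fLX.
have [w' [_ w'E]] := r_ray _ 1 (XP _ Xx0) ler01.
(* The direction [r] has only a real preimage so far, the difference of two points of [D]. A
   positive multiple [r *+ c] has an integer one and replaces [r]. *)
have [|c [u [c0 uL]]] := @integral_solution R _ _ L r (w' - toR x0).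
  by rewrite mulmxBl w'E addrC addKr scale1r.
have [||L' [N' [X' [fLX' tX' L'L]]]] := above_step fLX uL _ _.
- move=> w l Dw l0; have [|w1 [Dw1 w1E]] := r_ray w (l * c%:R) Dw.
    by rewrite mulr_ge0.
  by exists w1; split=> //; rewrite w1E map_intrMn -(scaler_nat c (toR r)) scalerA.
- have [i ri] := rV0Pn _ r0; apply/rV0Pn; exists i.
  by rewrite mulmxnE mulrn_eq0 negb_or -lt0n c0.
apply/tX'/(IH _ _ _ _ fLX').
by apply: leq_trans (proper_card L'L) _; rewrite -ltnS.
Qed.

(** The elimination starts from the identity matrix, modulus 1 and all lattice points of [D], where
    factoring and lifting are trivial. *)
Theorem midpoint_affine_translates : exists a K : nat, (0 < a)%N /\
  forall x m, D (toR x) -> (K <= f x)%N -> exists2 y, D (toR y) & f y = (f x + m * a)%N.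
Proof.
apply: (@factors_translates _ 1%:M 1 P (ltnSn _)); split=> //.
- move=> M w q _ Dw; rewrite map_mx1 !mulmx1 => wq; exists q; split=> //.
  - by rewrite /P /= -wq.
  - by rewrite mulmx1.
  - exact: congr_row_refl.
- by move=> x y _ _; rewrite !mulmx1 => ->.
Qed.

End MidpointAffine.

(** * From MICP representations to eventual periodicity *)

Lemma int_pointsP (R : realType) d (x : 'rV[R]_d) :
  int_points R d x <-> exists z : 'rV[int]_d, x = map_mx intr z.
Proof.
split=> [/mxOverP xint|[z ->]]; last first.
  by apply/mxOverP => i j; rewrite mxE intr_int.
exists (map_mx Num.floor x); apply/matrixP => i j; rewrite !mxE.
by rewrite floorK.
Qed.

Section MICP.
Variables (R : realType) (S : set nat) (d p : nat).
Variables (C : set 'rV[R]_d) (A : 'rV[R]_d -> set 'rV[R]_(1 + p)).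
Hypothesis rep : MICP_representation (nat_embed R S) C A.
Hypothesis A_neq0 : forall z, C z -> A z !=set0.

Local Notation toR := (map_mx (intr : int -> R)).

Lemma micp_value (z : 'rV[int]_d) v : C (toR z) -> A (toR z) v ->
  exists2 n, S n & v 0 0 = n%:R.
Proof.
have [_ _ SE] := rep => Cz Av.
have : nat_embed R S (lsubmx v).
  by rewrite SE; exists (toR z); [split=> //; apply/int_pointsP; exists z|exists v].
move=> [n Sn /matrixP/(_ 0 0)]; rewrite !mxE => e; exists n => //.
by rewrite e; congr (v _ _); exact/val_inj.
Qed.

Lemma micp_value_unique (z : 'rV[int]_d) v v' : C (toR z) ->
  A (toR z) v -> A (toR z) v' -> v 0 0 = v' 0 0.
Proof.
(* two distinct natural values would put a half-integer into the projection *)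
have lt_false w w' n n' : C (toR z) -> A (toR z) w -> A (toR z) w' ->
    w 0 0 = n%:R -> w' 0 0 = n'%:R -> ~ (n < n')%N.
  move=> Cz Aw Aw' wn wn' nn'; have [_ [[/(_ _ Cz)/convex_setP cA _] _ _] _] := rep.
  (* This weight moves the value exactly 1/2 below [n']. *)
  pose l : R := (2 * (n' - n)%:R)^-1.
  have c0 : (1 : R) <= (n' - n)%:R by rewrite ler1n subn_gt0.
  have lc : l * (2 * (n' - n)%:R) = 1 by rewrite mulVf //; lra.
  have l01 : 0 <= l <= 1.
    by rewrite invr_ge0 invf_le1; lra.
  have [k _] := micp_value Cz (cA _ _ _ l01 Aw Aw').
  rewrite !mxE wn wn'; have -> : n%:R = n'%:R - (n' - n)%:R :> R by rewrite natrB ?(ltnW nn')//; lra.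
  move=> e; have : (2 * n')%:R = (2 * k + 1)%:R :> R.
    by rewrite natrD !natrM -e; lra.
  by move/eqP; rewrite eqr_nat; lia.
move=> Cz Av Av'; have [n _ vn] := micp_value Cz Av; have [n' _ vn'] := micp_value Cz Av'.
have h1 := lt_false _ _ _ _ Cz Av Av' vn vn'; have h2 := lt_false _ _ _ _ Cz Av' Av vn' vn.
by rewrite vn vn'; congr (_%:R); lia.
Qed.

(** Each fibre over a lattice point of [C] has a single value. Convexity of the family at weight 1/2
    puts the mean of the values at [x] and [y] into the fibre over [z]. *)
Lemma micp_function : exists f : 'rV[int]_d -> nat,
  [/\ forall n, S n <-> exists2 z, C (toR z) & f z = n
    & forall x y z, C (toR x) -> C (toR y) -> C (toR z) -> x + y = z + z ->
      (f x + f y = 2 * f z)%N].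
Proof.
have [_ [[_ cA] _ _] SE] := rep.
have /choice[f hf] : forall z, exists n, C (toR z) ->
    S n /\ forall v, A (toR z) v -> v 0 0 = n%:R.
  move=> z; have [Cz|nC] := pselect (C (toR z)); last by exists 0%N.
  have [v Av] := A_neq0 Cz; have [n Sn vn] := micp_value Cz Av; exists n => _; split=> // w Aw.
  by rewrite -vn; exact: micp_value_unique Aw Av.
exists f; split.
  move=> n; split=> [Sn|[z /hf[Sfz _] <- //]].
  have : nat_embed R S (const_mx n%:R) by exists n.
  rewrite SE => -[z0 [+ /int_pointsP[z zE]] [v + ve]]; rewrite zE => Cz Av.
  exists z => //; have [_ /(_ _ Av)] := hf _ Cz.
  have <- : lsubmx v 0 0 = v 0 0 by rewrite mxE; congr (v _ _); exact/val_inj.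
  by rewrite ve mxE => /eqP; rewrite eqr_nat => /eqP.
move=> x y z Cx Cy Cz xyz.
have [[v Av] [w Aw]] := (A_neq0 Cx, A_neq0 Cy).
have half : (1 - 2^-1 : R) = 2^-1 by lra.
have /(cA _ _ 2^-1 Cx Cy) : 0 <= (2^-1 : R) <= 1 by lra.
have -> : 2^-1 *: toR x + (1 - 2^-1) *: toR y = toR z.
  rewrite half -scalerDr -map_mxD xyz map_mxD -mulr2n -(scaler_nat 2 (toR z)) scalerA.
  by rewrite mulVf ?scale1r ?pnatr_eq0.
move=> /(_ (2^-1 *: v + (1 - 2^-1) *: w)) Avw.
have [_ /(_ _ Av) vx] := hf _ Cx; have [_ /(_ _ Aw) wy] := hf _ Cy.
have [_ /(_ _ (Avw _))] := hf _ Cz.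
rewrite !mxE vx wy => e.
apply/eqP; rewrite -(eqr_nat R) natrD natrM; apply/eqP; rewrite -e; first lra.
by exists v => //; exists w.
Qed.

Lemma micp_eventually_periodic :
  bounded_set (C `&` int_points R d) \/ rationally_unbounded_int (C `&` int_points R d) ->
  eventually_periodic S.
Proof.
have [f [Sf f_mid]] := micp_function.
have [cC _ _] := rep.
case=> [/bounded_rowP[K CK]|[_ _ [I [Ifin _ [D_convex _ D_unb]]]]].
  have [T [h hh]] := bounded_row_code d K.
  have small x j : C (toR x) -> `|toR x 0 j| <= K.
    by move=> Cx; apply: CK; split=> //; apply/int_pointsP; exists x.
  have [|G hG] := @finite_classes_bound _ _ h f [set x | C (toR x)].
    by move=> x y Cx Cy /hh -> // j; exact: small.
  exists 1%N, G.+1; split=> // n Gn /Sf[z Cz fz].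
  by have := hG z Cz; rewrite fz leqNgt Gn.
set B := (C `&` int_points R d) `\` I in D_convex D_unb.
set D := conv_hull B in D_convex D_unb.
have DC : D `<=` C by apply: conv_hull_min => // x [[]].
have [|L|a [K [a0 H]]] := @midpoint_affine_translates R d D f D_convex.
- by move=> x y z /DC Cx /DC Cy /DC Cz; exact: f_mid.
- have [/bounded_rowP[K LK]|[r [/int_pointsP[r' ->] r0 r_ray]]] := D_unb (map_mx intr L).
    left; exists K => w Dw j; rewrite map_intr_ratr; apply: LK; by exists w.
  right; exists r'; split; first by apply: contra_neq r0 => ->; rewrite map_mx0.
  (* Rational unboundedness gives rays only from lattice points of the image. The points of [D]
     having such rays form a convex set containing the generators, whose images under an integer
     matrix are lattice points. *)
  suff : D `<=` [set w | forall l : R, 0 <= l ->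
      exists w', D w' /\ w' *m toR L = w *m toR L + l *: toR r'].
    by move=> DW w l /DW; apply.
  apply: conv_hull_min.
    apply/convex_setP => x y t t01 xW yW l l0.
    have [[x' [Dx' x'E]] [y' [Dy' y'E]]] := (xW l l0, yW l l0).
    exists (t *: x' + (1 - t) *: y'); split; first by move/convex_setP: D_convex; apply.
    rewrite !mulmxDl -!scalemxAl x'E y'E !scalerDr addrACA; congr (_ + _).
    by rewrite -scalerDl subrKC scale1r.
  move=> b Bb l l0; have [[Cb /int_pointsP[z zE]] _] := Bb.
  have [||w Dw wE] := r_ray (b *m toR L) l _ _ l0; last by exists w; rewrite -wE -map_intr_ratr.
    by apply/int_pointsP; exists (z *m L); rewrite zE map_mxM.
  by rewrite map_intr_ratr; exists b => //; exact: sub_conv_hull.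
(* Values from [G] on are not attained on the exceptional set [I], so their lattice points lie in
   [D]. *)
have [G hG] := finite_set_nat_bound (finite_image (f \o map_mx Num.floor) Ifin).
exists a, (maxn G K); split=> // n; rewrite geq_max => /andP[Gn Kn] /Sf[z Cz fz].
have Dz : D (toR z).
  apply: sub_conv_hull; split; first by split=> //; apply/int_pointsP; exists z.
  move=> Iz; have := hG (f z); rewrite fz ltnNge Gn => /(_ _)/negP; apply=> //.
  exists (toR z) => //=; rewrite -fz; congr f.
  by apply/matrixP => i j; rewrite !mxE intrKfloor.
have [|y Dy fy] := H z 1%N Dz; first by rewrite fz.
by apply/Sf; exists y; [exact: DC|rewrite fy fz mul1n].
Qed.

End MICP.

(** * Fourier-Motzkin elimination and Dickson's lemma *)

Section FourierMotzkin.
Variable R : realType.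

Local Notation toRq := (map_mx (ratr : rat -> R)).

Lemma exists_argmax (I : finType) (Q : pred I) (F : I -> R) (i0 : I) : Q i0 ->
  exists i, Q i /\ forall j, Q j -> F j <= F i.
Proof.
by move=> Qi0; case: (@Order.TotalTheory.arg_maxP _ _ _ i0 Q F Qi0) => i Qi Fi; exists i.
Qed.

(** The columns of [Y] are Fourier-Motzkin multipliers: one for each pair of an upper and a lower
    bound on [y], one for each constraint free of [y], and zero columns for the remaining pairs. *)
Lemma eliminate_one_variable m (a : 'rV[rat]_m) :
  exists (k : nat) (Y : 'M[rat]_(m, k)), forall h : 'rV[R]_m,
    (exists y : R, forall i, y * ratr (a 0 i) <= h 0 i) <->
    forall j, 0 <= (h *m toRq Y) 0 j.
Proof.
pose c (q : 'I_m * 'I_m) : 'cV[rat]_m :=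
  if (0 < a 0 q.1) && (a 0 q.2 < 0) then
    a 0 q.1 *: delta_mx q.2 0 - a 0 q.2 *: delta_mx q.1 0
  else if a 0 q.1 == 0 then delta_mx q.1 0 else 0.
exists #|{: 'I_m * 'I_m}|, (\matrix_(i, j) c (enum_val j) i 0) => h.
have hY j : (h *m toRq (\matrix_(i, j) c (enum_val j) i 0)) 0 j =
    (h *m toRq (c (enum_val j))) 0 0.
  by rewrite !mxE; apply: eq_bigr => i _; rewrite !mxE.
have cE q : (h *m toRq (c q)) 0 0 =
    if (0 < a 0 q.1) && (a 0 q.2 < 0) then
      ratr (a 0 q.1) * h 0 q.2 - ratr (a 0 q.2) * h 0 q.1
    else if a 0 q.1 == 0 then h 0 q.1 else 0.
  rewrite /c; case: ifP => _.
    by rewrite map_mxB !map_mxZ !map_delta_mx mulmxBr -!scalemxAr -!colE !mxE.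
  by case: ifP => _; [rewrite map_delta_mx -colE mxE|rewrite map_mx0 mulmx0 mxE].
split=> [[y hy] j|H].
  rewrite hY cE; have := hy (enum_val j).1; have := hy (enum_val j).2.
  case: ifP => [/andP[p0 n0]|_].
    have : 0 < ratr (a 0 (enum_val j).1) :> R by rewrite ltr0q.
    have : ratr (a 0 (enum_val j).2) < 0 :> R by rewrite ltrq0.
    by nra.
  by case: eqP => // ->; rewrite rmorph0 mulr0.
have F1 p n : 0 < a 0 p -> a 0 n < 0 ->
    h 0 n / ratr (a 0 n) <= h 0 p / ratr (a 0 p).
  move=> p0 n0; have := H (enum_rank (p, n)); rewrite hY cE enum_rankK /= p0 n0 /=.
  have pR : 0 < ratr (a 0 p) :> R by rewrite ltr0q.
  have nR : ratr (a 0 n) < 0 :> R by rewrite ltrq0.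
  by move=> F; rewrite ler_ndivrMr // mulrAC ler_pdivrMr //; lra.
have F2 p : a 0 p = 0 -> 0 <= h 0 p.
  by move=> p0; have := H (enum_rank (p, p)); rewrite hY cE enum_rankK /= p0 ltxx eqxx.
(* Take the largest lower bound; if there is none, the smallest upper bound; if there is none
   either, 0. *)
have [y [yp yn]] : exists y : R, (forall p, 0 < a 0 p -> y <= h 0 p / ratr (a 0 p)) /\
    (forall n, a 0 n < 0 -> h 0 n / ratr (a 0 n) <= y).
  have [/existsP[n0 n00]|/existsPn nn] := boolP [exists n, a 0 n < 0].
    have [n [nP nmax]] := @exists_argmax _ (fun n => a 0 n < 0) (fun n => h 0 n / ratr (a 0 n)) n0 n00.
    by exists (h 0 n / ratr (a 0 n)); split=> // p p0; exact: F1.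
  have [/existsP[p0 p00]|/existsPn pp] := boolP [exists p, 0 < a 0 p].
    have [p [pP pmax]] := @exists_argmax _ (fun p => 0 < a 0 p) (fun p => - (h 0 p / ratr (a 0 p))) p0 p00.
    exists (h 0 p / ratr (a 0 p)); split=> [q q0|n n0]; last by have := nn n; rewrite n0.
    by rewrite -lerN2 pmax.
  by exists 0; split=> [q q0|n n0]; [have := pp q; rewrite q0|have := nn n; rewrite n0].
exists y => i; have [ai|ai|ai] := ltrgtP (a 0 i) 0.
- by rewrite -ler_ndivrMr ?ltrq0 // yn.
- by rewrite -ler_pdivlMr ?ltr0q // yp.
- by rewrite ai rmorph0 mulr0 F2.
Qed.

(** Eliminating the first variable leaves a system of the same shape in the others, with matrix
    [dsubmx A *m Y1] and right-hand side [h *m Y1]; multipliers compose. *)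
Lemma eliminate_variables p m (A : 'M[rat]_(p, m)) :
  exists (k : nat) (Y : 'M[rat]_(m, k)), forall h : 'rV[R]_m,
    (exists y : 'rV[R]_p, forall i, (y *m toRq A) 0 i <= h 0 i) <->
    forall j, 0 <= (h *m toRq Y) 0 j.
Proof.
elim: p m A => [|p IH] m A.
  exists m, 1%:M => h; rewrite map_mx1 mulmx1; split=> [[y hy] j|hj].
    by have := hy j; rewrite flatmx0 mulmx0 mxE.
  by exists 0 => i; rewrite mul0mx mxE.
rewrite -[p.+1]/(1 + p)%N in A *.
have [k1 [Y1 H1]] := eliminate_one_variable (usubmx A).
have [k2 [Y2 H2]] := IH _ (dsubmx A *m Y1).
exists k2, (Y1 *m Y2) => h.
have AE (y : 'rV[R]_(1 + p)) i : (y *m toRq A) 0 i =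
    y 0 0 * ratr (usubmx A 0 i) + (rsubmx y *m toRq (dsubmx A)) 0 i.
  rewrite -{1}[A]vsubmxK -{1}[y]hsubmxK map_col_mx mul_row_col mxE; congr (_ + _).
  rewrite [LHS]mxE big_ord1 [lsubmx y 0 0]mxE [toRq _ 0 i]mxE; congr (y _ _ * _); exact/val_inj.
rewrite map_mxM mulmxA -H2; split=> [[y hy]|[y hy]].
  exists (rsubmx y) => j.
  have : forall i, y 0 0 * ratr (usubmx A 0 i) <= (h - rsubmx y *m toRq (dsubmx A)) 0 i.
    by move=> i; have := hy i; rewrite AE sub_rowE lerBrDr.
  move=> /(ex_intro (fun t : R => forall i, t * _ <= _) _)/H1/(_ j).
  by rewrite mulmxBl sub_rowE subr_ge0 map_mxM mulmxA.
have /H1[t ht] : forall j, 0 <= ((h - y *m toRq (dsubmx A)) *m toRq Y1) 0 j.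
  move=> j; have := hy j.
  by rewrite mulmxBl sub_rowE subr_ge0 map_mxM mulmxA.
exists (row_mx t%:M y) => i; have := ht i.
rewrite AE row_mxKr sub_rowE lerBrDr.
suff -> : (row_mx t%:M y : 'rV[R]_(1 + p)) 0 0 = t by [].
by rewrite mxE; case: splitP => // j _; rewrite !ord1 mxE eqxx mulr1n.
Qed.

End FourierMotzkin.

(** Repeatedly pick an index at which [u] attains its minimum over the remaining tail. *)
Lemma nondecreasing_subseq (u : nat -> nat) : exists phi : nat -> nat,
  (forall m n, (m < n)%N -> (phi m < phi n)%N) /\
  (forall m n, (m <= n)%N -> (u (phi m) <= u (phi n))%N).
Proof.
have /choice[e he] : forall N, exists n, (N <= n)%N /\ forall m, (N <= m)%N -> (u n <= u m)%N.
  move=> N; pose Q v := `[< exists2 n, (N <= n)%N & u n = v >].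
  have exQ : exists v, Q v by exists (u N); apply/asboolP; exists N.
  case: (ex_minnP exQ) => v /asboolP[n Nn <-] vmin; exists n; split=> // m Nm.
  by apply: vmin; apply/asboolP; exists m.
pose phi := fix phi n := if n is n'.+1 then e (phi n').+1 else e 0%N.
have phiS n : (phi n < phi n.+1)%N by have [] := he (phi n).+1.
have phi_inc : forall m n, (m < n)%N -> (phi m < phi n)%N by apply: homo_ltn ltn_trans phiS.
exists phi; split=> // m n; rewrite leq_eqVlt => /predU1P[-> //|mn].
case: m mn => [|m] mn; first by have [_] := he 0%N; apply.
by have [_] := he (phi m).+1; apply; apply: phi_inc; exact: ltn_trans mn.
Qed.

(** Nested subsequences make one coordinate after another nondecreasing; the first two terms of the
    last one are comparable. *)
Lemma dickson k (s : nat -> 'I_k -> nat) :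
  exists i j, (i < j)%N /\ forall l, (s i l <= s j l)%N.
Proof.
suff [phi [pinc pmon]] : exists phi : nat -> nat,
    (forall m n, (m < n)%N -> (phi m < phi n)%N) /\
    forall l m n, (m <= n)%N -> (s (phi m) l <= s (phi n) l)%N.
  by exists (phi 0%N), (phi 1%N); split=> [|l]; [exact: pinc|exact: pmon].
suff /(_ k (leqnn k))[phi [pinc pmon]] : forall k', (k' <= k)%N -> exists phi : nat -> nat,
    (forall m n, (m < n)%N -> (phi m < phi n)%N) /\
    forall l : 'I_k, (l < k')%N -> forall m n, (m <= n)%N -> (s (phi m) l <= s (phi n) l)%N.
  by exists phi; split=> // l; exact: pmon.
elim=> [_|k' IH k'k]; first by exists id.
have [phi [pinc pmon]] := IH (ltnW k'k).
have [psi [qinc qmon]] := nondecreasing_subseq (fun n => s (phi n) (Ordinal k'k)).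
exists (phi \o psi); split=> [m n mn|l]; first by apply/pinc/qinc.
rewrite ltnS leq_eqVlt => /predU1P[lk|lk] m n mn /=.
  by have := qmon _ _ mn; rewrite (_ : l = Ordinal k'k) //; exact/val_inj.
apply: pmon => //; move: mn; rewrite leq_eqVlt => /predU1P[-> //|/qinc/ltnW //].
Qed.

(** * From MILP representations to eventual periodicity *)

Section MILP.
Variable R : realType.

Local Notation toR := (map_mx (intr : int -> R)).
Local Notation toRq := (map_mx (ratr : rat -> R)).

(** Once the continuous variables are eliminated, clearing denominators gives integer data, so that
    the slacks at integer points are natural numbers. *)
Lemma milp_integer_system n (T : set 'rV[R]_n) : rational_MILP_representable T ->
  exists (d k : nat) (V : 'M[int]_(n + d, k)) (beta : 'rV[int]_k),
    forall x : 'rV[int]_n,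
      T (toR x) <-> exists z : 'rV[int]_d, forall j, (row_mx x z *m V) 0 j <= beta 0 j.
Proof.
move=> [p [d [M [[m [A [b ->]]] ->]]]].
pose Axy := usubmx A; pose B := col_mx (usubmx Axy) (dsubmx A).
have [k [Y HY]] := @eliminate_variables R _ _ (dsubmx Axy).
(* Stacking the right-hand side on the coefficients gives both the same denominator [c]. *)
have [c [U [c0 UE]]] := rat_mx_common_denominator (col_mx (b *m Y) (B *m Y)).
have AE (x : 'rV[R]_n) (y : 'rV[R]_p) (z : 'rV[R]_d) :
    row_mx (row_mx x y) z *m toRq A = row_mx x z *m toRq B + y *m toRq (dsubmx Axy).
  rewrite -{1}[A]vsubmxK map_col_mx mul_row_col -{1}[usubmx A]vsubmxK map_col_mx mul_row_col.
  by rewrite /B map_col_mx mul_row_col addrAC.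
have sysE (x : 'rV[int]_n) (z : 'rV[int]_d) :
    (exists y : 'rV[R]_p, forall i, (row_mx (row_mx (toR x) y) (toR z) *m toRq A) 0 i <= ratr (b 0 i)) <->
    forall j, (row_mx x z *m dsubmx U) 0 j <= usubmx U 0 j.
  have -> : (exists y : 'rV[R]_p, forall i,
      (row_mx (row_mx (toR x) y) (toR z) *m toRq A) 0 i <= ratr (b 0 i)) <->
      exists y : 'rV[R]_p, forall i, (y *m toRq (dsubmx Axy)) 0 i <=
        (toRq b - toR (row_mx x z) *m toRq B) 0 i.
    by split=> -[y hy]; exists y => i; have := hy i;
       rewrite AE sub_rowE map_row_mx add_rowE [toRq b 0 i]mxE lerBrDl.
  rewrite HY.
  suff e j : c%:R * ((toRq b - toR (row_mx x z) *m toRq B) *m toRq Y) 0 j =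
      (usubmx U 0 j - (row_mx x z *m dsubmx U) 0 j)%:~R.
    have cR : 0 < c%:R :> R by rewrite ltr0n.
    by split=> h j; have := h j; rewrite -(pmulr_rge0 _ cR) e ler0z subr_ge0.
  have U1 : toR (usubmx U) = c%:R *: toRq (b *m Y).
    have -> : usubmx U = usubmx (col_mx (usubmx U) (dsubmx U)) by rewrite col_mxKu.
    rewrite vsubmxK map_intr_ratr map_usubmx UE scale_col_mx col_mxKu map_mxZ /=.
    by rewrite rmorph_nat.
  have U2 : toR (dsubmx U) = c%:R *: toRq (B *m Y).
    by rewrite map_intr_ratr map_dsubmx UE scale_col_mx col_mxKd map_mxZ rmorph_nat.
  rewrite mulmxBl sub_rowE rmorphB /= mulrBr; congr (_ - _).
    have -> : (usubmx U 0 j)%:~R = toR (usubmx U) 0 j by rewrite [RHS]mxE.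
    by rewrite U1 -map_mxM [RHS]mxE.
  have -> : ((row_mx x z *m dsubmx U) 0 j)%:~R = toR (row_mx x z *m dsubmx U) 0 j by rewrite [RHS]mxE.
  by rewrite map_mxM U2 -scalemxAr -mulmxA -map_mxM [RHS]mxE.
exists d, k, (dsubmx U), (usubmx U) => x; split.
  move=> [v [w [wA /= /int_pointsP[z zE]] <-] vx].
  exists z; apply/sysE; exists (rsubmx (lsubmx w)) => i.
  have := wA i; rewrite -zE -vx.
  by rewrite !hsubmxK.
move=> [z /sysE[y hy]].
exists (row_mx (toR x) y); last by rewrite row_mxKl.
exists (row_mx (row_mx (toR x) y) (toR z)); last by rewrite row_mxKl.
by split=> //=; rewrite row_mxKr; apply/int_pointsP; exists z.
Qed.

Lemma milp_eventually_periodic (S : set nat) (A0 T : set 'rV[R]_1) :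
  finite_set A0 -> rational_MILP_representable T -> nat_embed R S = A0 `|` T ->
  eventually_periodic S.
Proof.
move=> A0fin /milp_integer_system[d [k [V [beta HT]]]] SE.
pose x (n : nat) : 'rV[int]_1 := const_mx n%:Z.
have xE n : const_mx n%:R = toR (x n) by apply/matrixP => i j; rewrite !mxE.
have SP n : S n <-> A0 (toR (x n)) \/ T (toR (x n)).
  have -> : S n <-> nat_embed R S (toR (x n)).
    split=> [Sn|[m Sm /matrixP/(_ 0 0)]]; first by exists n.
    by rewrite !mxE => /eqP; rewrite eqr_nat => /eqP <-.
  by rewrite SE.
have [N0 hN0] : exists N, forall n, A0 (toR (x n)) -> (n < N)%N.
  have [N hN] := finite_set_nat_bound (finite_image (fun v : 'rV[R]_1 => absz (Num.floor (v 0 0))) A0fin).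
  exists N => n A0n; apply: hN; exists (toR (x n)) => //.
  by rewrite !mxE intrKfloor.
have [[N hN]|unb] := pselect (exists N, forall n, T (toR (x n)) -> (n < N)%N).
  exists 1%N, (maxn N0 N); split=> // n; rewrite geq_max => /andP[n0 n1] /SP[/hN0|/hN].
    by rewrite ltnNge n0.
  by rewrite ltnNge n1.
have /choice[e he] : forall N, exists n, (N <= n)%N /\ T (toR (x n)).
  move=> N; apply: contrapT => no; apply: unb; exists N => n Tn; rewrite ltnNge; apply/negP => Nn.
  by apply: no; exists n.
pose X := fix X n := if n is n'.+1 then e (X n').+1 else e 0%N.
have TX n : T (toR (x (X n))) by case: n => [|n]; [case: (he 0%N)|case: (he (X n).+1)].
have XS n : (X n < X n.+1)%N by have [] := he (X n).+1.
have X_inc : forall m n, (m < n)%N -> (X m < X n)%N by apply: homo_ltn ltn_trans XS.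
have /choice[z hz] : forall n, exists z, forall j, (row_mx (x (X n)) z *m V) 0 j <= beta 0 j.
  by move=> n; apply/HT.
(* The slacks are nonnegative by [hz], so [absz] keeps their values. Slacks growing from [i] to [j]
   mean that the difference of the two solutions can be added to any solution, with period
   [X j - X i]. *)
have [i [j [ij slack]]] := dickson (fun n l => absz (beta 0 l - (row_mx (x (X n)) (z n) *m V) 0 l)%R).
have ray l : (row_mx (x (X j)) (z j) *m V) 0 l <= (row_mx (x (X i)) (z i) *m V) 0 l.
  by have := slack l; have := hz i l; have := hz j l; lia.
exists (X j - X i)%N, N0; split; first by rewrite subn_gt0; exact: X_inc.
move=> n n0 /SP[/hN0|]; first by rewrite ltnNge n0.
move=> /HT[w hw]; apply/SP; right; apply/HT; exists (w + (z j - z i)) => l.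
have -> : row_mx (x (n + (X j - X i))%N) (w + (z j - z i)) =
    row_mx (x n) w + (row_mx (x (X j)) (z j) - row_mx (x (X i)) (z i)).
  rewrite opp_row_mx !add_row_mx; congr row_mx; apply/matrixP => a b; rewrite !mxE.
  by have := X_inc _ _ ij; lia.
rewrite mulmxDl mulmxBl add_rowE -[leRHS]addr0 lerD ?hw //.
by rewrite sub_rowE subr_le0.
Qed.

End MILP.

(** * Representing progressions *)

(** A nonzero entry is at least 1 and exhausts the sum, so the other entries vanish. *)
Lemma simplex_integer_point k (lam : 'rV[int]_k) :
  (forall i, 0 <= lam 0 i) -> lam *m const_mx 1 = 1%:M ->
  exists i, lam = delta_mx 0 i.
Proof.
move=> lam0 /matrixP/(_ 0 0); rewrite !mxE /= mulr1n => sum1.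
have {}sum1 : \sum_i lam 0 i = 1.
  by rewrite -sum1; apply: eq_bigr => i _; rewrite mxE mulr1.
have [/existsP[i li]|/existsPn no] := boolP [exists i, lam 0 i != 0]; last first.
  by move: sum1; rewrite big1 // => i _; apply/eqP; move: (no i); rewrite negbK.
exists i; have li0 := lam0 i.
have rest0 : 0 <= \sum_(j | j != i) lam 0 j by apply: sumr_ge0 => j _.
rewrite (bigD1 i) //= in sum1.
have [l1 r0] : lam 0 i = 1 /\ \sum_(j | j != i) lam 0 j = 0.
  move: li li0 rest0 sum1; move: (lam 0 i) (\sum_(j | j != i) _) => x y; lia.
apply/rowP => j; rewrite mxE eqxx /=; have [->|ji] := eqVneq j i; first by rewrite l1.
by move/eqP: r0; rewrite psumr_eq0 // => /allP/(_ j); rewrite mem_index_enum ji => /(_ isT)/eqP.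
Qed.

Section Progressions.
Variables (R : realType) (a k : nat) (s : 'I_k -> nat) (J : 'I_k -> bool).

Local Notation toR := (map_mx (intr : int -> R)).
Local Notation toRq := (map_mx (ratr : rat -> R)).

Lemma rational_polyhedronI N (M1 M2 : set 'rV[R]_N) :
  rational_polyhedron M1 -> rational_polyhedron M2 -> rational_polyhedron (M1 `&` M2).
Proof.
move=> [m1 [A1 [b1 ->]]] [m2 [A2 [b2 ->]]].
exists (m1 + m2)%N, (row_mx A1 A2), (row_mx b1 b2); apply/seteqP; split => v /=.
  move=> [h1 h2] i; rewrite map_row_mx mul_mx_row !mxE.
  case: splitP => j _; [have := h1 j|have := h2 j]; by rewrite !mxE.
rewrite map_row_mx mul_mx_row => h; split=> i.
  by have := h (lshift _ i); rewrite !row_mxEl.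
by have := h (rshift _ i); rewrite !row_mxEr.
Qed.

(** The blocks are the value, an empty continuous part, and the integer variables: a height and [k]
    weights. *)
Lemma rational_polyhedron_blocks m (X Y : 'M[rat]_(1, m)) (Z : 'M[rat]_(k, m)) (b : 'rV[rat]_m) :
  rational_polyhedron [set v : 'rV[R]_(1 + 0 + (1 + k)) | forall i,
    (lsubmx (lsubmx v) *m toRq X + (lsubmx (rsubmx v) *m toRq Y + rsubmx (rsubmx v) *m toRq Z)) 0 i
      <= ratr (b 0 i)].
Proof.
exists m, (col_mx (col_mx X (0 : 'M[rat]_(0, m))) (col_mx Y Z)), b.
have e (v : 'rV[R]_(1 + 0 + (1 + k))) :
    v *m toRq (col_mx (col_mx X (0 : 'M[rat]_(0, m))) (col_mx Y Z)) =
    lsubmx (lsubmx v) *m toRq X + (lsubmx (rsubmx v) *m toRq Y + rsubmx (rsubmx v) *m toRq Z).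
  rewrite !map_col_mx -{1}[v]hsubmxK mul_row_col -{1}[lsubmx v]hsubmxK mul_row_col.
  by rewrite -{1}[rsubmx v]hsubmxK mul_row_col map_mx0 mulmx0 addr0.
by apply/seteqP; split=> v /= h i; have := h i; rewrite e.
Qed.

Lemma milp_progressions :
  rational_MILP_representable
    (nat_embed R [set n | exists i m, n = (s i + a * m)%N /\ J i]).
Proof.
pose W : 'M[rat]_(k, 1) := \col_i (s i)%:R.
pose P m (X Y : 'M[rat]_(1, m)) (Z : 'M[rat]_(k, m)) (b : 'rV[rat]_m) := [set v : 'rV[R]_(1 + 0 + (1 + k)) | forall i : 'I_m,
    (lsubmx (lsubmx v) *m toRq X + (lsubmx (rsubmx v) *m toRq Y + rsubmx (rsubmx v) *m toRq Z)) 0 i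
      <= ratr (b 0 i)].
(* In order: weights nonnegative, weight [i] at most [J i], height [t] nonnegative, weights summing
   to 1 (two inequalities), and [x] equal to [a] times [t] plus the weighted sum of the [s i] (two
   inequalities). *)
pose M := P k 0 0 (- 1%:M) 0 `&` P k 0 0 1%:M (\row_i (J i)%:R) `&` P 1%N 0 (- 1%:M) 0 0 `&`
  P 1%N 0 0 (const_mx 1) (const_mx 1) `&` P 1%N 0 0 (- const_mx 1) (- const_mx 1) `&`
  P 1%N 1%:M (- a%:R%:M) (- W) 0 `&` P 1%N (- 1%:M) a%:R%:M W 0.
exists 0%N, (1 + k)%N, M; split.
  by do ?[apply: rational_polyhedronI]; exact: rational_polyhedron_blocks.
have ME (x : 'rV[R]_1) (y : 'rV[R]_0) (t : 'rV[int]_1) (lam : 'rV[int]_k) :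
    M (row_mx (row_mx x y) (toR (row_mx t lam))) <->
    exists i m, [/\ J i, t = const_mx m%:Z, lam = delta_mx 0 i & x = const_mx (s i + a * m)%:R].
  have PE m X Y Z b : P m X Y Z b (row_mx (row_mx x y) (toR (row_mx t lam))) <-> forall i,
      (x *m toRq X + (toR t *m toRq Y + toR lam *m toRq Z)) 0 i <= ratr (b 0 i).
    by rewrite /P /= !row_mxKl row_mxKr map_row_mx row_mxKl row_mxKr.
  set v := row_mx _ _ in PE *.
  have h1 : P k 0 0 (- 1%:M) 0 v <-> forall i, 0 <= lam 0 i.
    rewrite PE !map_mx0 !mulmx0 !add0r map_mxN map_mx1 mulmxN mulmx1.
    by split=> h i; have := h i; rewrite !mxE rmorph0 oppr_le0 ler0z.
  have h2 : P k 0 0 1%:M (\row_i (J i)%:R) v <-> forall i, lam 0 i <= (J i)%:R.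
    rewrite PE !map_mx0 !mulmx0 !add0r map_mx1 mulmx1.
    by split=> h i; have := h i; rewrite !mxE ratr_nat -(ler_int R) rmorph_nat.
  have h3 : P 1%N 0 (- 1%:M) 0 0 v <-> 0 <= t 0 0.
    rewrite PE !map_mx0 !mulmx0 !add0r addr0 map_mxN map_mx1 mulmxN mulmx1.
    split=> [/(_ 0)|h i]; rewrite !mxE rmorph0 oppr_le0 ler0z //.
    by rewrite !ord1.
  pose sigma := (lam *m const_mx 1 : 'rV_1) 0 0; pose omega := (toR lam *m toRq W) 0 0.
  have sE : (toR lam *m const_mx 1 : 'rV_1) 0 0 = sigma%:~R.
    have -> : const_mx 1 = toR (const_mx 1) :> 'cV[R]_k by apply/matrixP => p q; rewrite !mxE.
    by rewrite -map_mxM mxE.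
  have c3 : toRq (const_mx 1 : 'M[rat]_(k, 1)) = const_mx 1.
    by apply/matrixP => p q; rewrite !mxE rmorph1.
  have c1 : ratr ((const_mx 1 : 'rV[rat]_1) 0 0) = 1 :> R by rewrite mxE rmorph1.
  have c2 : ratr ((- const_mx 1 : 'rV[rat]_1) 0 0) = -1 :> R by rewrite !mxE rmorphN rmorph1.
  have h4 : P 1%N 0 0 (const_mx 1) (const_mx 1) v <-> sigma <= 1.
    rewrite PE !map_mx0 !mulmx0 !add0r c3.
    rewrite -(ler_int R) -sE.
    by split=> [/(_ 0)|h i]; rewrite ?(ord1 i) c1.
  have h5 : P 1%N 0 0 (- const_mx 1) (- const_mx 1) v <-> 1 <= sigma.
    rewrite PE !map_mx0 !mulmx0 !add0r map_mxN c3 mulmxN.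
    rewrite -(ler_int R) -sE -lerN2.
    by split=> [/(_ 0)|h i]; rewrite ?(ord1 i) c2 opp_rowE.
  have atE : (a%:R *: toR t) 0 0 = a%:R * (t 0 0)%:~R by rewrite !mxE.
  have c0 : ratr ((0 : 'rV[rat]_1) 0 0) = 0 :> R by rewrite mxE rmorph0.
  have h6 : P 1%N 1%:M (- a%:R%:M) (- W) 0 v <-> x 0 0 <= a%:R * (t 0 0)%:~R + omega.
    rewrite PE !map_mxN map_mx1 mulmx1 map_scalar_mx !mulmxN mul_mx_scalar rmorph_nat.
    by split=> [/(_ 0)|h i]; rewrite ?(ord1 i) !add_rowE !opp_rowE atE c0 -/omega -opprD subr_le0.
  have h7 : P 1%N (- 1%:M) a%:R%:M W 0 v <-> a%:R * (t 0 0)%:~R + omega <= x 0 0.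
    rewrite PE !map_mxN map_mx1 mulmxN mulmx1 map_scalar_mx mul_mx_scalar rmorph_nat.
    by split=> [/(_ 0)|h i]; rewrite ?(ord1 i) !add_rowE !opp_rowE atE c0 -/omega addrC subr_le0.
  have wE i : toR (delta_mx 0 i) *m toRq W = (s i)%:R%:M.
    by rewrite map_delta_mx -rowE; apply/matrixP => p q; rewrite !mxE !ord1 eqxx ratr_nat.
  split.
    move=> [[[[[[/h1 lam0 /h2 lamJ] /h3 t0] /h4 s1] /h5 s1'] /h6 x1] /h7 x2].
    have [|i lamE] := simplex_integer_point lam0.
      by apply/matrixP => p q; rewrite !ord1 [RHS]mxE eqxx; apply/eqP; rewrite eq_le s1 s1'.
    exists i, (absz (t 0 0)); split=> //.
    - by have := lamJ i; rewrite lamE mxE !eqxx; case: (J i).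
    - by apply/matrixP => p q; rewrite !ord1 mxE gez0_abs.
    - apply/matrixP => p q; rewrite !ord1 mxE natrD natrM.
      have -> : x 0 0 = a%:R * (t 0 0)%:~R + omega by apply/eqP; rewrite eq_le x1 x2.
      rewrite /omega lamE wE mxE eqxx mulr1n addrC; congr (_ + _ * _).
      by rewrite -[in LHS](gez0_abs t0).
  move=> [i [m [Ji tE lamE xE]]].
  have om : omega = (s i)%:R by rewrite /omega lamE wE mxE eqxx.
  have sg : sigma = 1 by rewrite /sigma lamE -rowE !mxE.
  have xE' : x 0 0 = a%:R * (t 0 0)%:~R + omega by rewrite xE tE om !mxE natrD natrM addrC.
  split; [split; [split; [split; [split; [split|]|]|]|]|].
  - by apply/h1 => j; rewrite lamE mxE; case: eqP.
  - by apply/h2 => j; rewrite lamE mxE eqxx /=; case: eqVneq => [->|]; rewrite ?Ji.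
  - by apply/h3; rewrite tE mxE.
  - by apply/h4; rewrite sg.
  - by apply/h5; rewrite sg.
  - by apply/h6; rewrite xE'.
  - by apply/h7; rewrite xE'.
apply/seteqP; split=> x.
  move=> [n [i [m [nE Ji]]] <-].
  exists (row_mx (const_mx n%:R) 0); last by rewrite row_mxKl.
  exists (row_mx (row_mx (const_mx n%:R) 0) (toR (row_mx (const_mx m%:Z) (delta_mx 0 i)))).
    split; last by rewrite /= row_mxKr; apply/int_pointsP; eexists.
    by apply/ME; exists i, m; rewrite nE.
  by rewrite row_mxKl.
move=> [v [w [Mw /int_pointsP[z zE]] <-] <-].
have := Mw; rewrite -[w]hsubmxK zE -[lsubmx w]hsubmxK -[z]hsubmxK => /ME[i [m [Ji _ _ xE]]].
by exists (s i + a * m)%N; [exists i, m|rewrite !row_mxKl].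
Qed.

End Progressions.

Lemma progression_form_milp (R : realType) (S : set nat) : progression_form S ->
  exists (A0 T : set 'rV[R]_1),
    [/\ finite_set A0, rational_MILP_representable T & nat_embed R S = A0 `|` T].
Proof.
move=> [a [k [s [J [_ SE]]]]].
exists [set const_mx (s i)%:R | i in [set: 'I_k]],
  (nat_embed R [set n | exists i m, n = (s i + a * m)%N /\ J i]); split.
- exact: finite_image.
- exact: milp_progressions.
apply/seteqP; split=> [_ [n /SE[i [m [nE Jm]]] <-]|x].
  by case: Jm => [Ji|m0]; [right; exists n => //; exists i, m|left; exists i; rewrite // nE m0 muln0 addn0].
case=> [[i _ <-]|[n [i [m [nE Ji]]] <-]].
  by exists (s i) => //; apply/SE; exists i, 0%N; rewrite muln0 addn0; split=> //; right.
by exists n => //; apply/SE; exists i, m; split=> //; left.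
Qed.

(** * MICP representation of progressions and isolated points *)

Section ProgressionsMICP.
Variables (R : realType) (a k : nat) (s : 'I_k -> nat) (J : 'I_k -> bool).

Local Notation toR := (map_mx (intr : int -> R)).

(* The disjunction restricts the faces without a progression to height 0, so the
   cone need not be closed. *)
Let cone : set 'rV[R]_(1 + k) := [set v |
  [/\ 0 <= lsubmx v 0 0, forall i, 0 <= rsubmx v 0 i, \sum_i rsubmx v 0 i = 1
    & lsubmx v 0 0 = 0 \/ exists2 i, J i & 0 < rsubmx v 0 i]].

Let weights : 'cV[R]_(1 + k) := col_mx (const_mx a%:R) (\col_i (s i)%:R).

(** A one-point fibre given by a linear functional: linearity makes the family convex, continuity
    makes it closed. *)
Let fiber (z : 'rV[R]_(1 + k)) : set 'rV[R]_(1 + 0) := [set const_mx ((z *m weights) 0 0)].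

Let vertex (i : 'I_k) (m : nat) : 'rV[int]_(1 + k) := row_mx (const_mx m%:Z) (delta_mx 0 i).

Let e0 : 'rV[int]_(1 + k) := row_mx (const_mx 1) 0.

Lemma vertexD i m n : vertex i (m + n) = vertex i m + e0 *+ n.
Proof.
rewrite /vertex /e0 -scaler_nat scale_row_mx scaler0 add_row_mx addr0; congr row_mx.
by apply/matrixP => p q; rewrite !mxE mulr1 natz PoszD.
Qed.

Lemma vertex_inj i i' m m' : vertex i m = vertex i' m' -> i = i' /\ m = m'.
Proof.
move=> /eq_row_mx[/matrixP/(_ 0 0) + /matrixP/(_ 0 i)]; rewrite !mxE !eqxx /= => -[->].
by case: eqP.
Qed.

Lemma cone_integer_points x : (cone `&` int_points R (1 + k)) x <->
  exists i m, (J i \/ m = 0%N) /\ x = toR (vertex i m).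
Proof.
split.
  move=> [Cx /int_pointsP[z xE]]; move: Cx; rewrite xE -[z]hsubmxK; move: (lsubmx z) (rsubmx z) => t lam.
  rewrite /cone /mkset map_row_mx row_mxKl row_mxKr => -[t0 lam0 lam1 tJ].
  have [||i lamE] := @simplex_integer_point _ lam.
  - by move=> i; have := lam0 i; rewrite mxE ler0z.
  - apply/matrixP => p q; rewrite !ord1 !mxE eqxx; apply/eqP; rewrite -(eqr_int R).
    rewrite rmorph_sum /= -{2}lam1; apply/eqP/eq_bigr => i _.
    by rewrite !mxE mulr1.
  move: t0; rewrite mxE ler0z => t0.
  exists i, (absz (t 0 0)); split; last first.
    rewrite lamE /vertex map_row_mx; congr (row_mx (toR _) _).
    by apply/matrixP => p q; rewrite !ord1 mxE gez0_abs.
  case: tJ => [|[j Jj]].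
    by rewrite mxE => /eqP; rewrite intr_eq0 => /eqP ->; right.
  by rewrite lamE !mxE eqxx /=; case: eqVneq => [<-|]; [left|rewrite ltxx].
move=> [i [m [Jm ->]]]; split; last by apply/int_pointsP; eexists.
rewrite /cone /mkset /vertex map_row_mx row_mxKl row_mxKr; split.
- by rewrite !mxE ler0z.
- by move=> j; rewrite !mxE ler0z ler0n.
- rewrite (bigD1 i) //= !mxE !eqxx big1 ?addr0 // => j ji.
  by rewrite !mxE (negbTE ji) andbF.
- case: Jm => [Ji|->]; last by left; rewrite !mxE.
  by right; exists i => //; rewrite !mxE !eqxx ltr01.
Qed.

(** In a proper combination, a positive flagged weight of either point stays positive; if neither
    has one, both heights are 0 and so is the combined height. *)
Lemma cone_convex : convex_set cone.
Proof.
apply/convex_setP => x y l /andP[l0 l1] [x0 xl xs xJ] [y0 yl ys yJ].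
have l1' : 0 <= 1 - l by lra.
have lE : lsubmx (l *: x + (1 - l) *: y) 0 0 = l * lsubmx x 0 0 + (1 - l) * lsubmx y 0 0.
  by rewrite !mxE.
have rE i : rsubmx (l *: x + (1 - l) *: y) 0 i = l * rsubmx x 0 i + (1 - l) * rsubmx y 0 i.
  by rewrite !mxE.
split.
- by rewrite lE addr_ge0 // mulr_ge0.
- by move=> i; rewrite rE addr_ge0 // mulr_ge0.
- under eq_bigr do rewrite rE.
  by rewrite big_split /= -!mulr_sumr xs ys; lra.
- have [->|lN0] := eqVneq l 0.
    by rewrite scale0r add0r subr0 scale1r.
  have [l1E|lN1] := eqVneq (1 - l) 0.
    by have -> : l = 1 by [lra]; rewrite subrr scale0r addr0 scale1r.
  have lp : 0 < l by rewrite lt_def lN0.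
  have lp' : 0 < 1 - l by rewrite lt_def lN1.
  case: xJ => [xz|[i Ji xi]]; last first.
    by right; exists i => //; rewrite rE ltr_wpDr ?mulr_ge0 // mulr_gt0.
  case: yJ => [yz|[i Ji yi]]; last first.
    by right; exists i => //; rewrite rE ltr_wpDl ?mulr_ge0 // mulr_gt0.
  by left; rewrite lE xz yz !mulr0 addr0.
Qed.

Lemma vertex_value i m : (toR (vertex i m) *m weights) 0 0 = (s i + a * m)%:R.
Proof.
rewrite /vertex map_row_mx /weights mul_row_col add_rowE map_delta_mx -rowE !mxE big_ord1 !mxE.
by rewrite natrD natrM addrC mulrC.
Qed.

Lemma fiber_closed_convex_family : closed_convex_family cone fiber.
Proof.
split.
- split=> [z _|z z' l _ _ _].
    apply/convex_setP => x y l _ -> ->.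
    by rewrite -scalerDl subrKC scale1r.
  move=> _ [x -> [y -> <-]]; rewrite /fiber /= mulmxDl -!scalemxAl add_rowE.
  by apply/matrixP => p q; rewrite !mxE.
- move=> z _; exact/accessible_closed_set1/hausdorff_accessible/norm_hausdorff.
move=> z_ x_ z x zcvg xcvg _ Ax _; rewrite /fiber /=.
have WE (v : 'rV[R]_(1 + k)) : (v *m weights) 0 0 = \sum_j v 0 j * weights j 0 by rewrite mxE.
have coord (n : nat) (u_ : nat -> 'rV[R]_n) (u : 'rV[R]_n) j : u_ @ \oo --> u ->
    (fun m => u_ m 0 j) @ \oo --> u 0 j.
  move=> ucvg; exact: (@cvg_comp _ _ _ u_ (fun v : 'rV[R]_n => v 0 j) _ _ _ ucvg (@coord_continuous R 1 n 0 j u)).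
apply/rowP => j; rewrite mxE.
apply: (@cvg_unique _ (@norm_hausdorff _ _) ((fun m => x_ m 0 j) @ \oo)).
  exact: coord.
rewrite (_ : (fun m => x_ m 0 j) = fun m => \sum_i z_ m 0 i * weights i 0); last first.
  by apply/funext => m; rewrite (Ax m) mxE WE.
rewrite WE; apply: cvg_big => [|i _]; first exact: add_continuous.
by apply: cvgM; [exact: coord|exact: cvg_cst].
Qed.

Lemma fiber_represents :
  nat_embed R [set n | exists i m, n = (s i + a * m)%N /\ (J i \/ m = 0%N)] =
  \bigcup_(z in cone `&` int_points R (1 + k)) proj_x (fiber z).
Proof.
have val x : proj_x (fiber x) = [set const_mx ((x *m weights) 0 0)].
  apply/seteqP; split=> [_ [_ -> <-]|_ ->]; last first.
    by exists (const_mx ((x *m weights) 0 0)) => //; apply/matrixP => p q; rewrite !mxE.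
  by apply/matrixP => p q; rewrite !mxE.
apply/seteqP; split=> x.
  move=> [n [i [m [-> Jm]]] <-]; exists (toR (vertex i m)); first by apply/cone_integer_points; exists i, m.
  by rewrite val vertex_value.
move=> [z /cone_integer_points[i [m [Jm ->]]]]; rewrite val vertex_value => ->.
by exists (s i + a * m)%N => //; exists i, m.
Qed.

Let ray_points : set 'rV[R]_(1 + k) := [set x | exists i m, J i /\ x = toR (vertex i m)].

(** The condition is convex in [x], and above a generator the shifted point lies on the segment to a
    higher generator on the same vertical line. *)
Lemma hull_ray x (l : R) : conv_hull ray_points x -> 0 <= l -> conv_hull ray_points (x + l *: toR e0).
Proof.
move=> Bx l0; move: x Bx.
apply: conv_hull_min; first apply/convex_setP => x y t t01 Dx Dy /=.
  have -> : t *: x + (1 - t) *: y + l *: toR e0 =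
      t *: (x + l *: toR e0) + (1 - t) *: (y + l *: toR e0).
    by rewrite !scalerDr addrACA -scalerDl subrKC scale1r.
  by have /convex_setP := @conv_hull_convex R _ ray_points; apply.
move=> _ [i [m [Ji ->]]] /=; pose n := (Num.bound l).+1.
have n0 : 0 < n%:R :> R by rewrite ltr0n.
have ln : l <= n%:R.
  by rewrite (le_trans (ltW (archi_boundP l0))) // ler_nat leqnSn.
have -> : toR (vertex i m) + l *: toR e0 =
    (l / n%:R) *: toR (vertex i (m + n)) + (1 - l / n%:R) *: toR (vertex i m).
  rewrite vertexD map_mxD map_intrMn -(scaler_nat n (toR e0)) scalerDr scalerA divfK ?gt_eqF //.
  by rewrite addrAC -scalerDl subrKC scale1r.
have /convex_setP := @conv_hull_convex R _ ray_points; apply.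
- by rewrite divr_ge0 ?ler0n //= ler_pdivrMr // mul1r.
- by apply: sub_conv_hull; exists i, (m + n)%N.
- by apply: sub_conv_hull; exists i, m.
Qed.

(** Heights disappear under [L], so the generators have only finitely many images; [K] sums the
    absolute values of all their entries. *)
Lemma hull_image_bounded (L : 'M[R]_(1 + k)) : toR e0 *m L = 0 ->
  bounded_set [set v *m L | v in conv_hull ray_points].
Proof.
move=> e0L; apply/bounded_rowP.
pose K : R := \sum_i \sum_j `|(toR (vertex i 0) *m L) 0 j|.
exists K => _ [v + <-] j; move: v.
apply: conv_hull_min.
  apply/convex_setP => x y l /andP[l0 l1] /= xK yK.
  rewrite mulmxDl -!scalemxAl add_rowE !scale_rowE (le_trans (ler_normD _ _)) //.
  have l1' : 0 <= 1 - l by rewrite subr_ge0.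
  rewrite !normrM (ger0_norm l0) (ger0_norm l1').
  have -> : K = l * K + (1 - l) * K by rewrite -mulrDl subrKC mul1r.
  by rewrite lerD // ler_wpM2l.
move=> _ [i [m [Ji ->]]] /=.
rewrite -[m]add0n vertexD map_mxD map_intrMn mulmxDl mulmxMnl e0L mul0rn addr0.
rewrite /K (bigD1 i) //= (bigD1 j) //= -addrA lerDl addr_ge0 //.
  by apply: sumr_ge0.
by apply: sumr_ge0 => p _; apply: sumr_ge0.
Qed.

Lemma cone_bounded_or_rationally_unbounded :
  bounded_set (cone `&` int_points R (1 + k)) \/ rationally_unbounded_int (cone `&` int_points R (1 + k)).
Proof.
have [/existsP[i0 Ji0]|/existsPn noJ] := boolP [exists i, J i]; last first.
  left; apply/bounded_rowP; exists 1 => x /cone_integer_points[i [m [Jm ->]]] j.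
  have -> : m = 0%N by case: Jm => // Ji; have := noJ i; rewrite Ji.
  rewrite mxE /vertex mxE; case: splitP => p _; rewrite !mxE ?normr0 ?ler01 //.
  by case: (_ && _); rewrite ?normr1 ?normr0 ?ler01.
(* An unflagged vertex has no lattice point above it; removing these finitely many points leaves
   whole vertical rays. *)
right; pose I := [set toR (vertex i 0) | i in [set i | ~~ J i]].
have BE : (cone `&` int_points R (1 + k)) `\` I = ray_points.
  apply/seteqP; split=> x.
    move=> [/cone_integer_points[i [m [Jm ->]]] nI]; exists i, m; split=> //.
    case: Jm => // m0; apply/negPn/negP => nJ; apply: nI; exists i => //; by rewrite m0.
  move=> [i [m [Ji ->]]]; split; first by apply/cone_integer_points; exists i, m; split=> //; left.
  by move=> [i' /= nJ /map_intr_inj/vertex_inj[ii _]]; move: nJ; rewrite ii Ji.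
split; first by move=> x [].
  move=> fin.
  have [N hN] := finite_set_nat_bound (finite_image (fun v : 'rV[R]_(1 + k) => absz (Num.floor (lsubmx v 0 0))) fin).
  suff : (N < N)%N by rewrite ltnn.
  apply: hN; exists (toR (vertex i0 N)).
    by apply/cone_integer_points; exists i0, N; split=> //; left.
  by rewrite /vertex map_row_mx row_mxKl !mxE intrKfloor.
exists I; split.
- by apply: finite_image; exact: finite_finset.
- by move=> _ [i nJ <-]; apply/cone_integer_points; exists i, 0%N; split=> //; right.
rewrite BE; split; first exact: conv_hull_convex.
  move=> /bounded_rowP[K DK]; pose m := Num.bound `|K|.
  have Bm : conv_hull ray_points (toR (vertex i0 m)) by apply: sub_conv_hull; exists i0, m.
  have := DK _ Bm (lshift k 0); rewrite mxE /vertex row_mxEl mxE normr_nat => mK.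
  have := archi_boundP (normr_ge0 K); rewrite ltNge -/m => /negP; apply.
  exact: le_trans (ler_norm K).
move=> L /=; pose eL : 'rV[rat]_(1 + k) := map_mx intr e0 *m L.
have eLR : toR e0 *m map_mx ratr L = map_mx ratr eL by rewrite map_mxM -map_intr_ratr.
have [eL0|eL0] := eqVneq eL 0.
  by left; apply: hull_image_bounded; rewrite eLR eL0 map_mx0.
(* The vertical direction has a nonzero rational image, and its multiple by [c] is the required
   integer ray direction. *)
right; have [c [U [c0 UE]]] := rat_mx_common_denominator eL.
have UR : toR U = c%:R *: (toR e0 *m map_mx ratr L).
  by rewrite map_intr_ratr UE map_mxZ rmorph_nat eLR.
exists (toR U); split; first by apply/int_pointsP; exists U.
  apply: contra_neq eL0 => U0.
  have {}U0 : U = 0 by apply: (@map_intr_inj R); rewrite U0 map_mx0.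
  apply: (@scalerI _ _ c%:R); first by rewrite pnatr_eq0 -lt0n.
  by rewrite -UE U0 map_mx0 scaler0.
move=> _ l _ [v Dv <-] l0; exists (v + (l * c%:R) *: toR e0).
  by apply: hull_ray => //; rewrite mulr_ge0.
by rewrite mulmxDl -scalemxAl UR scalerA.
Qed.

Lemma micp_progressions :
  rational_MICP_representable
    (nat_embed R [set n | exists i m, n = (s i + a * m)%N /\ (J i \/ m = 0%N)]).
Proof.
exists (1 + k)%N, 0%N, cone, fiber; split; last exact: cone_bounded_or_rationally_unbounded.
  by split; [exact: cone_convex|exact: fiber_closed_convex_family|exact: fiber_represents].
by move=> z _; exists (const_mx ((z *m weights) 0 0)).
Qed.

End ProgressionsMICP.

(** * Assembling the equivalences *)

Theorem theorem2 (R : realType) (S : set nat) :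
  let a := rational_MICP_representable (nat_embed R S) in
  let b := exists (k : nat) (A0 : set nat) (A : 'I_k -> set nat),
      [/\ finite_set A0,
          forall i, infinite_arith_progression (A i)
        & S = A0 `|` \bigcup_(i in [set: 'I_k]) A i] in
  let c := exists (A0 T : set 'rV[R]_1),
      [/\ finite_set A0,
          rational_MILP_representable T
        & nat_embed R S = A0 `|` T] in
  (a <-> b) /\ (b <-> c).
Proof.
move=> a b c.
(* Implications out of (b) pass through the form with a common step, and implications into (b)
   through eventual periodicity. *)
have bE : b -> progression_form S.
  move=> [k [A0 [A [A0fin Aprog SE]]]].
  exact/eventually_periodic_form/(eventually_periodic_unions A0fin Aprog SE).
have Eb : eventually_periodic S -> b.
  by move=> /eventually_periodic_form; exact: progression_form_unions.
split; split.
- move=> [d [p [C [A [rep A_neq0 C_rat]]]]].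
  by apply: Eb; exact: micp_eventually_periodic rep A_neq0 C_rat.
- move=> /bE[m [k [s [J [_ SE]]]]]; rewrite /a.
  have -> : S = [set n | exists i l, n = (s i + m * l)%N /\ (J i \/ l = 0%N)].
    by apply/seteqP; split=> n /SE.
  exact: micp_progressions.
- by move=> /bE; exact: progression_form_milp.
- move=> [A0 [T [A0fin Tmilp SE]]].
  by apply: Eb; exact: milp_eventually_periodic A0fin Tmilp SE.
Qed.
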